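(* If a Bruhat interval polytope $Q_{v,w}$ is toric, then its combinatorial type is determined by the poset structure of $[v,w]$. That is, if $v\le w$ in $\mathfrak{S}_n$ and $v'\le w'$ in $\mathfrak{S}_m$ are such that $Q_{v,w}$ and $Q_{v',w'}$ are both toric and the intervals $[v,w]$ and $[v',w']$ are isomorphic as posets, then $Q_{v,w}$ and $Q_{v',w'}$ are combinatorially equivalent.
   Context: $\mathfrak{S}_n$ is the symmetric group on $\{1,\dots,n\}$, $\ell(\cdot)$ is the length with respect to the simple transpositions $s_i=(i,i+1)$, and $\le$ is Bruhat order. For $v\le w$, $[v,w]=\{z\in\mathfrak{S}_n\mid v\le z\le w\}$ (a poset under Bruhat order), and the Bruhat interval polytope $Q_{v,w}$ is the convex hull in $\mathbb{R}^n$ of the points $(z(1),\dots,z(n))$ for $z\in[v,w]$. $Q_{v,w}$ is called toric if $\dim Q_{v,w}=\ell(w)-\ell(v)$. Two polytopes are combinatorially equivalent (have the same combinatorial type) if their face posets are isomorphic. *)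

(* Defs.v *)
From mathcomp Require Import all_boot all_order all_algebra all_fingroup.
From mathcomp Require Import boolp classical_sets functions reals.

Set Implicit Arguments.
Unset Strict Implicit.
Unset Printing Implicit Defensive.

Import GRing.Theory Num.Theory.

(** ** Length and Bruhat order on the symmetric group *)

Definition simple_transpositions (n : nat) : {set 'S_n} :=
  [set tperm p.1 p.2 | p in [pred p : 'I_n * 'I_n | p.2 == p.1.+1 :> nat]].

Lemma tperm_gen_simple n (i j : 'I_n) :
  tperm i j \in <<simple_transpositions n>>%g.
Proof.
wlog le_ij : i j / i <= j.
  by move=> H; case/orP: (leq_total i j) => /H //; rewrite tpermC.
have [k] := ubnP (j - i); elim: k i j le_ij => // k IH i j le_ij lt_k.
have [<-|ne_ij] := eqVneq i j; first by rewrite tperm1 group1.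
have lt_ij : i < j by rewrite ltn_neqAle ne_ij.
have [b def_b] : exists b : 'I_n, b = i.+1 :> nat.
  by exists (Ordinal (leq_ltn_trans lt_ij (ltn_ord j))).
have simple_ib : tperm i b \in <<simple_transpositions n>>%g.
  apply: mem_gen; apply/imsetP; exists (i, b) => //.
  by rewrite inE /= def_b.
have [eq_bj|ne_bj] := eqVneq b j; first by rewrite -eq_bj.
have ne_ib : i != b by rewrite -val_eqE /= def_b neq_ltn leqnn.
have -> : tperm i j = (tperm b j ^ tperm i b)%g.
  rewrite tpermJ tpermR tpermD //.
rewrite groupJ //; apply: IH; rewrite def_b // subnS.
by case: (j - i) (subn_gt0 i j) lt_k => [|d]; rewrite lt_ij.
Qed.

Lemma word_exists n (w : 'S_n) :
  exists k, w \in (simple_transpositions n ^+ k)%g.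
Proof.
have : w \in <<simple_transpositions n>>%g.
  have [ts -> _] := prod_tpermP w.
  by apply: group_prod => p _; apply: tperm_gen_simple.
case/gen_prodgP=> k [c c_in ->]; exists k.
have -> : (simple_transpositions n ^+ k =
           \prod_(i < k) simple_transpositions n)%g.
  by rewrite prodg_const card_ord.
by apply/prodsgP; exists c => // i _; apply: c_in.
Qed.

(* [A ^+ k] is the set of products of [k] elements of [A], so this is the
   least number of factors in a word in the simple transpositions. *)
Definition perm_length (n : nat) (w : 'S_n) : nat := ex_minn (word_exists w).

(* The reflections of 'S_n are all the transpositions, and they are closed
   under conjugation, so multiplying on the left or on the right makes no
   difference. *)
Definition bruhat_step (n : nat) : rel 'S_n := fun u z =>
  [exists i : 'I_n, exists j : 'I_n, (i != j) && (z == (u * tperm i j)%g)]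
  && (perm_length u < perm_length z).

Definition bruhat_le (n : nat) : rel 'S_n := connect (@bruhat_step n).

Definition bruhat_interval (n : nat) (v w : 'S_n) : {set 'S_n} :=
  [set z | bruhat_le v z && bruhat_le z w]%SET.

Local Open Scope ring_scope.
Local Open Scope classical_set_scope.

(** ** Order isomorphism *)

Definition poset_isomorphic (T T' : Type) (A : set T) (leT : T -> T -> Prop)
    (B : set T') (leT' : T' -> T' -> Prop) : Prop :=
  exists f : T -> T', set_bij A B f /\
    forall x y, A x -> A y -> (leT' (f x) (f y) <-> leT x y).

(** ** Convex geometry in R^n *)

Section ConvexGeometry.
Variables (R : realType) (n : nat).
Implicit Types (A P F : set 'rV[R]_n).

Definition convex_hull A : set 'rV[R]_n :=
  [set x | exists k (p : 'I_k -> 'rV[R]_n) (a : 'I_k -> R),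
     [/\ forall i, A (p i), forall i, 0 <= a i, \sum_(i < k) a i = 1
       & x = \sum_(i < k) a i *: p i]].

Definition affine_hull A : set 'rV[R]_n :=
  [set x | exists k (p : 'I_k -> 'rV[R]_n) (a : 'I_k -> R),
     [/\ forall i, A (p i), \sum_(i < k) a i = 1
       & x = \sum_(i < k) a i *: p i]].

(* The affine hull is the translate [x0 + U] of a [d]-dimensional subspace. *)
Definition has_dim A (d : nat) : Prop :=
  exists (x0 : 'rV[R]_n) (U : {vspace 'rV[R]_n}),
    affine_hull A = [set x | x - x0 \in U] /\ (\dim U = d)%N.

Definition dot (c x : 'rV[R]_n) : R := \sum_(i < n) c 0 i * x 0 i.

(* The inequality is allowed to be trivial ([c = 0]): the empty set and [P]
   itself are faces. *)
Definition is_face P F : Prop :=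
  exists (c : 'rV[R]_n) (b : R),
    (forall x, P x -> dot c x <= b) /\ F = [set x | P x /\ dot c x = b].

End ConvexGeometry.

Definition combinatorially_equivalent (R : realType) (n m : nat)
    (P : set 'rV[R]_n) (Q : set 'rV[R]_m) : Prop :=
  poset_isomorphic (is_face P) (fun F G => F `<=` G)
                   (is_face Q) (fun F G => F `<=` G).

(** ** Bruhat interval polytopes *)

(* ['I_n] is {0, ..., n-1}, whence the shift of the values by one. *)
Definition perm_point (R : realType) (n : nat) (z : 'S_n) : 'rV[R]_n :=
  \row_(i < n) (z i).+1%:R.

Definition bruhat_polytope (R : realType) (n : nat) (v w : 'S_n) :
    set 'rV[R]_n :=
  convex_hull [set perm_point R z | z in [set` bruhat_interval v w]].
Arguments bruhat_polytope R {n} v w.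

Definition toric (R : realType) (n : nat) (v w : 'S_n) : Prop :=
  has_dim (bruhat_polytope R v w) (perm_length w - perm_length v).

(* Main.v *)
(* Let [v, w] be toric and order positions by a linear functional c.  Every cover
   x < x(a b) of [v, w] gets the label (a, b), and labels are compared as the slopes of
   the edges in a planar projection.  Flipping an ascent in a rank-two interval raises the
   first label, so each interval has a descending chain; it is unique, by Newman's lemma:
   all maximal chains are connected by flips, and the rank-three intervals, whose labels
   form a forest in the toric case, reduce to a finite check.  A local maximum of a generic
   functional on [v, w] lies on the descending chain from v to w at the point where labels
   turn from positive to negative, hence it is unique.

   Perturbing an arbitrary functional upwards (downwards) along Bruhat order shows that the
   set where it is maximal has a largest (smallest) element, and is the whole interval
   between them.  Conversely, because the labels of a maximal chain are linearly independent,
   for a coatom y of [p, q] some functional is constant on [p, y] and smaller at q; its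
   perturbation has y as a local, thus global, maximum, so [p, y] is a face.  Hence the
   nonempty faces of Q_{v,w} correspond to the subintervals of [v, w]. *)

Require Import Defs.
From mathcomp Require Import all_boot all_order all_algebra all_fingroup.
From mathcomp Require Import zify ring lra.

Set Implicit Arguments.
Unset Strict Implicit.
Unset Printing Implicit Defensive.

(** * Descending chains in labelled posets *)

Section LabelledPoset.
Variables (T : finType) (le : rel T) (len : T -> nat).
Hypothesis le_refl : reflexive le.
Hypothesis le_trans : transitive le.
Hypothesis le_len : forall x y, le x y -> len x <= len y.
Hypothesis le_len_eq : forall x y, le x y -> len y <= len x -> x = y.

Definition cov : rel T := fun x y => le x y && (len y == (len x).+1).

Hypothesis atom_ex : forall x y, le x y -> x != y -> exists2 a, cov x a & le a y.

Definition adj (x w : T) : rel T := fun a a' =>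
  [&& cov x a, cov x a' & [exists b, [&& cov a b, cov a' b & le b w]]].

Hypothesis atoms_connected : forall x w a a',
  cov x a -> le a w -> cov x a' -> le a' w -> connect (adj x w) a a'.

Variable lam : T -> T -> nat.

Hypothesis lam_inj : forall x a a', cov x a -> cov x a' -> lam x a = lam x a' -> a = a'.
Hypothesis lam_neq : forall x a b, cov x a -> cov a b -> lam x a != lam a b.
Hypothesis flip_ascent : forall x a b, cov x a -> cov a b -> lam x a < lam a b ->
  exists a', [/\ cov x a', cov a' b & lam x a < lam x a'].
Hypothesis descent2_uniq : forall x a a' y, cov x a -> cov a y -> cov x a' -> cov a' y ->
  lam a y < lam x a -> lam a' y < lam x a' -> a = a'.

Variables lo hi : T.
Hypothesis descent3_uniq : forall x a b a' b' y, le lo x -> le y hi ->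
  cov x a -> cov a b -> cov b y -> cov x a' -> cov a' b' -> cov b' y ->
  lam b y < lam a b < lam x a -> lam b' y < lam a' b' < lam x a' -> a = a'.

Lemma cov_le x y : cov x y -> le x y. Proof. by case/andP. Qed.
Lemma cov_len x y : cov x y -> len y = (len x).+1. Proof. by case/andP => _ /eqP. Qed.
(* Since flipping ascents yields descending chains starting with the largest label, this
   says that [a] starts a descending chain from [x] to [w]. *)
Definition good w x a := forall b, cov a b -> le b w -> lam a b < lam x a.

Definition top w x : T :=
  if [pick a | cov x a && le a w] is Some a0
  then [arg max_(a > a0 | cov x a && le a w) lam x a] else x.

Lemma topP x w : le x w -> x != w ->
  [/\ cov x (top w x), le (top w x) w &
      forall a, cov x a -> le a w -> lam x a <= lam x (top w x)].
Proof.
move=> xw neq; rewrite /top; case: pickP => [a0 a0P|no].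
  case: arg_maxnP => // a /andP[xa aw] am; split=> // a' xa' aw'.
  by apply: am; rewrite xa' aw'.
by have [a xa aw] := atom_ex xw neq; move: (no a); rewrite xa aw.
Qed.

Lemma top_good x w : le x w -> x != w -> good w x (top w x).
Proof.
move=> xw neq b; have [xa aw am] := topP xw neq => ab bw.
have := lam_neq xa ab; rewrite neq_ltn => /orP[lt|//].
have [a' [xa' ab' lt']] := flip_ascent xa ab lt.
by have := am a' xa' (le_trans (cov_le ab') bw); lia.
Qed.

Section Reduction.
Variables x w : T.

Definition arrow : rel T := fun a a' =>
  [&& cov x a, cov x a', lam x a < lam x a' &
      [exists b, [&& cov a b, cov a' b & le b w]]].

Definition sink a := [&& cov x a, le a w &
  [forall b, cov a b && le b w ==> (lam a b < lam x a)]].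

Lemma sinkP a : reflect [/\ cov x a, le a w & good w x a] (sink a).
Proof.
apply: (iffP and3P) => -[xa aw g]; split=> //.
  by move=> b ab bw; move/forallP: g => /(_ b); rewrite ab bw.
by apply/forallP => b; apply/implyP => /andP[ab bw]; apply: g.
Qed.

Lemma arrows_lam a a' : connect arrow a a' -> lam x a <= lam x a'.
Proof.
case/connectP => p; elim: p a => [|b p IH] a /=; first by move=> _ ->.
by case/andP=> /and4P[_ _ lt _] /IH/[apply]; lia.
Qed.

Lemma arrows_sink_ex a : cov x a -> le a w ->
  exists2 g, sink g & connect arrow a g.
Proof.
pose m := \max_(b : T) lam x b.
have [k] := ubnP (m - lam x a); elim: k a => // k IH a lek xa aw.
case: (boolP (sink a)) => [sa|]; first by exists a.
rewrite /sink xa aw /= negb_forall => /existsP[b].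
rewrite negb_imply -leqNgt => /andP[/andP[ab bw] le_l].
have lt : lam x a < lam a b by have := lam_neq xa ab; lia.
have [a' [xa' ab' lt']] := flip_ascent xa ab lt.
have aw' := le_trans (cov_le ab') bw.
have m' : lam x a' <= m by apply: (leq_bigmax a').
have [g sg cg] := IH a' ltac:(lia) xa' aw'.
exists g => //; apply: connect_trans cg; apply: connect1.
by rewrite /arrow xa xa' lt' /=; apply/existsP; exists b; rewrite ab ab'.
Qed.

Lemma sink_stop a g : sink a -> connect arrow a g -> g = a.
Proof.
move=> /sinkP[xa aw ga] /connectP[[|a' p] /=]; first by move=> _ ->.
case/andP=> /and4P[_ xa' lt /existsP[b /and3P[ab ab' bw]]].
have lt2 := ga b ab bw.
have lt3 : lam x a' < lam a' b \/ lam a' b < lam x a'.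
  by have := lam_neq xa' ab'; lia.
suff : exists c, [/\ cov x c, cov c b, lam x a < lam x c & lam c b < lam x c].
  case=> c [xc cb ltc ltc'] _ _.
  by have e := descent2_uniq xa ab xc cb lt2 ltc'; move: ltc; rewrite e ltnn.
pose P c := cov x c && cov c b.
have Pa' : P a' by rewrite /P xa' ab'.
case: (arg_maxnP (lam x) Pa') => c /andP[xc cb] cm.
have lec := cm a' Pa'; exists c; split=> //; first by lia.
have := lam_neq xc cb; rewrite neq_ltn => /orP[ltc|//].
have [c' [xc' cb' ltc']] := flip_ascent xc cb ltc.
by have := cm c'; rewrite /P xc' cb' => /(_ isT); lia.
Qed.

End Reduction.

Lemma arrow_sub x c w : le c w -> subrel (arrow x c) (arrow x w).
Proof.
move=> cw a a' /and4P[xa xa' lt /existsP[b /and3P[ab ab' bw]]].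
rewrite /arrow xa xa' lt /=; apply/existsP; exists b.
by rewrite ab ab' (le_trans bw cw).
Qed.

(* Newman's lemma: arrows raise the label, diverging arrows [a -> a1], [a -> a2] are joined
   by following the reduction of [[a, w]] through rank-three intervals starting at [x]. *)
Lemma sink_uniq x w g g' : le lo x -> le w hi -> sink x w g -> sink x w g' -> g = g'.
Proof.
have [d] := ubnP (len w - len x); elim: d x w g g' => // d IHd x w g g' led lox whi.
move=> sg sg'; have /sinkP[xg gw Gg] := sg; have /sinkP[xg' gw' Gg'] := sg'.
have lw := le_len gw; have lw' := le_len gw'; have lg := cov_len xg; have lg' := cov_len xg'.
have [r1|r1] := eqVneq (len w) (len x).+1.
  have -> : g = w by apply: le_len_eq => //; rewrite r1 lg.
  by apply/esym/le_len_eq => //; rewrite r1 lg'.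
have [r2|r2] := eqVneq (len w) (len x).+2.
  have gcw : cov g w by rewrite /cov /= gw r2 lg eqxx.
  have gcw' : cov g' w by rewrite /cov /= gw' r2 lg' eqxx.
  by apply: (descent2_uniq xg gcw xg' gcw'); [exact: Gg gcw (le_refl w) | exact: Gg' gcw' (le_refl w)].
have [r3|r3] := eqVneq (len w) (len x).+3.
  have ne u : le u w -> len u = (len x).+1 -> u != w.
    by move=> _ lu; apply/eqP => e; move: r3; rewrite -e; lia.
  have [gb bw _] := topP gw (ne _ gw lg); have tg := top_good gw (ne _ gw lg).
  have [gb' bw' _] := topP gw' (ne _ gw' lg'); have tg' := top_good gw' (ne _ gw' lg').
  have cb : cov (top w g) w by rewrite /cov /= bw r3 (cov_len gb) lg eqxx.
  have cb' : cov (top w g') w by rewrite /cov /= bw' r3 (cov_len gb') lg' eqxx.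
  apply: (descent3_uniq lox whi xg gb cb xg' gb' cb').
    by rewrite Gg ?andbT //; apply: tg.
  by rewrite Gg' ?andbT //; apply: tg'.
have r4 : (len x).+3 < len w.
  by clear -r1 r2 r3 lw lg; move: r1 r2 r3 lw; rewrite lg; lia.
clear r1 r2 r3.
have hi_of u : le u w -> le u hi by move=> uw; apply: le_trans uw whi.
have lo_of u : cov x u -> le lo u by move=> /cov_le; apply: le_trans.
have nf a : cov x a -> le a w -> forall g g', sink x w g -> sink x w g' ->
    connect (arrow x w) a g -> connect (arrow x w) a g' -> g = g'.
  have [m lem] : exists m, forall u, lam x u <= m.
    by exists (\max_(b : T) lam x b) => u; apply: (leq_bigmax u).
  have [k] := ubnP (m - lam x a); elim: k a => // k IHk a lek xa aw h h' sh sh'.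
  have IH a' : cov x a' -> le a' w -> lam x a < lam x a' -> forall g g',
      sink x w g -> sink x w g' ->
      connect (arrow x w) a' g -> connect (arrow x w) a' g' -> g = g'.
    move=> xa' aw' lt; apply: IHk => //.
    by have := lem a'; clear -lek lt; lia.
  have join c a1 a2 h1 h2 : le c w -> len c <= (len x).+3 ->
      cov x a1 -> cov x a2 -> le a1 c -> le a2 c -> lam x a < lam x a1 -> lam x a < lam x a2 ->
      sink x w h1 -> sink x w h2 ->
      connect (arrow x w) a1 h1 -> connect (arrow x w) a2 h2 -> h1 = h2.
    move=> cw lc xa1 xa2 a1c a2c lt1 lt2 sh1 sh2 c1 c2.
    have [s1 ss1 cs1] := arrows_sink_ex xa1 a1c.
    have [s2 ss2 cs2] := arrows_sink_ex xa2 a2c.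
    have e : s1 = s2 by apply: (IHd x c) => //; [clear -led lc r4; lia | apply: hi_of].
    have up := connect_sub (fun _ _ h => connect1 (arrow_sub cw h)).
    have /sinkP[xs s1c _] := ss1.
    have [s ss cs] := arrows_sink_ex xs (le_trans s1c cw).
    rewrite (IH a1 xa1 (le_trans a1c cw) lt1 h1 s) //; last first.
      by apply: connect_trans cs; apply: up.
    apply: (IH a2 xa2 (le_trans a2c cw) lt2 s h2) => //.
    by apply: connect_trans cs; rewrite e; apply: up.
  have Jq : forall b1 b2, connect (arrow a w) b1 b2 -> cov a b1 -> le b1 w ->
      lam x a < lam a b1 ->
      forall a1 a2 h1 h2, cov x a1 -> cov a1 b1 -> cov x a2 -> cov a2 b2 ->
      lam x a < lam x a1 -> lam x a < lam x a2 -> sink x w h1 -> sink x w h2 ->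
      connect (arrow x w) a1 h1 -> connect (arrow x w) a2 h2 -> h1 = h2.
    move=> b1 b2 /connectP[p]; elim: p b1 => [|b' p IHp] b1 /=.
      move=> _ -> ab1 b1w ltb a1 a2 h1 h2 xa1 a1b xa2 a2b lt1 lt2 sh1 sh2.
      apply: (join b1) => //; try exact: cov_le.
      by rewrite (cov_len a1b) (cov_len xa1).
    case/andP=> ar pp lp ab1 b1w ltb a1 a2 h1 h2 xa1 a1b xa2 a2b lt1 lt2 sh1 sh2 c1 c2.
    have /and4P[_ ab' ltb' /existsP[c /and3P[b1c b'c cw]]] := ar.
    have [a' [xa' ab'' lt']] := flip_ascent xa ab' (ltn_trans ltb ltb').
    have aw' : le a' w by apply: le_trans (cov_le ab'') (le_trans (cov_le b'c) cw).
    have [h0 sh0 ch0] := arrows_sink_ex xa' aw'.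
    have -> : h1 = h0.
      apply: (join c a1 a') => //.
      - by rewrite (cov_len b1c) (cov_len a1b) (cov_len xa1).
      - exact: le_trans (cov_le a1b) (cov_le b1c).
      - exact: le_trans (cov_le ab'') (cov_le b'c).
    apply: (IHp b' pp lp ab' (le_trans (cov_le b'c) cw) _ a' a2) => //.
    exact: ltn_trans ltb ltb'.
  case: (boolP (sink x w a)) => sa.
    by move=> /(sink_stop sa) -> /(sink_stop sa) ->.
  case/connectP=> [[|a1 p1] /=]; first by move=> _ e; move: sa; rewrite -e sh.
  case/andP=> ar1 p1P l1.
  case/connectP=> [[|a2 p2] /=]; first by move=> _ e; move: sa; rewrite -e sh'.
  case/andP=> ar2 p2P l2.
  have ca1 : connect (arrow x w) a1 h by apply/connectP; exists p1.
  have ca2 : connect (arrow x w) a2 h' by apply/connectP; exists p2.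
  have asc a' b : arrow x w a a' -> cov a b -> cov a' b -> le b w -> lam x a < lam a b.
    case/and4P=> _ xa' lt _ ab ab' bw.
    have := lam_neq xa ab; rewrite neq_ltn => /orP[//|lt'].
    have sa' : sink x b a.
      apply/sinkP; split=> //; first exact: cov_le.
      by move=> b' ab1 bb; rewrite (le_len_eq bb) // (cov_len ab) (cov_len ab1).
    have [s ss cs] := arrows_sink_ex xa' (cov_le ab').
    have es : a = s.
      by apply: (IHd x b) => //; [rewrite (cov_len ab) (cov_len xa); clear -led r4; lia | apply: hi_of].
    by have := arrows_lam cs; rewrite -es leqNgt lt.
  have /and4P[_ xa1 lt1 /existsP[b1 /and3P[ab1 a1b1 b1w]]] := ar1.
  have /and4P[_ xa2 lt2 /existsP[b2 /and3P[ab2 a2b2 b2w]]] := ar2.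
  have ltb1 := asc a1 b1 ar1 ab1 a1b1 b1w.
  have ltb2 := asc a2 b2 ar2 ab2 a2b2 b2w.
  have [B1 sB1 cB1] := arrows_sink_ex ab1 b1w.
  have [B2 sB2 cB2] := arrows_sink_ex ab2 b2w.
  have eB : B1 = B2.
    by apply: (IHd a w) => //; [rewrite (cov_len xa); clear -led r4; lia | apply: lo_of].
  have /sinkP[aB Bw _] := sB1.
  have ltB : lam x a < lam a B1 by apply: leq_trans (arrows_lam cB1).
  have [c [xc cB ltc]] := flip_ascent xa aB ltB.
  have [s ss cs] := arrows_sink_ex xc (le_trans (cov_le cB) Bw).
  rewrite (Jq b1 B1 cB1 ab1 b1w ltb1 a1 c h s) //.
  by apply/esym/(Jq b2 B2 cB2 ab2 b2w ltb2 a2 c h' s) => //; rewrite -eB.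
have /connectP[p] := atoms_connected xg gw xg' gw'.
have := connect0 (arrow x w) g.
move: {1 2 3 5 6}g xg gw => a xa aw cg pP lp.
elim: p a xa aw cg pP lp => [|a' p IHp] a xa aw cg /=.
  by move=> _ e; apply: (nf a xa aw) => //; rewrite e.
case/andP=> /and3P[_ xa' /existsP[b /and3P[ab ab' bw]]] pP lp.
have aw' := le_trans (cov_le ab') bw.
apply: (IHp a' xa' aw' _ pP lp).
have [s ss cs] := arrows_sink_ex xa' aw'.
have [s' ss' cs'] := arrows_sink_ex xa aw.
have e' : g = s' by apply: (nf a xa aw).
case: (ltngtP (lam x a) (lam x a')) => [lt|lt|/(lam_inj xa xa') <-//].
- have ar : arrow x w a a' by rewrite /arrow xa xa' lt; apply/existsP; exists b; rewrite ab ab'.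
  rewrite (nf a xa aw g s) //; exact: connect_trans (connect1 ar) cs.
- have ar : arrow x w a' a by rewrite /arrow xa xa' lt; apply/existsP; exists b; rewrite ab ab'.
  exact: connect_trans (connect1 ar) cg.
Qed.

Lemma good_top x w a : le lo x -> le w hi -> cov x a -> le a w -> good w x a -> a = top w x.
Proof.
move=> lox whi xa aw ga; have xw := le_trans (cov_le xa) aw.
have ne : x != w.
  by apply/eqP => e; have := le_len aw; rewrite (cov_len xa) e ltnn.
have [xt tw _] := topP xw ne; have tg := top_good xw ne.
by apply: (@sink_uniq x w) => //; apply/sinkP.
Qed.

Variable bnd : nat.

(* Labels at least [bnd] stand for the covers along which the functional grows. *)
Definition local_max x w z := [/\ le x z, le z w,
  forall y, cov z y -> le y w -> lam z y < bnd
  & forall u, cov u z -> le x u -> bnd <= lam u z].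

Lemma local_max_up x w z a : local_max x w z -> cov x a -> le a z -> local_max a w z.
Proof.
move=> [xz zw up dn] xa az; split=> // u uz au; apply: dn => //.
exact: le_trans (cov_le xa) au.
Qed.

Lemma local_max_top x w z : le lo x -> le w hi -> local_max x w z -> x != z ->
  top w x = top z x /\ bnd <= lam x (top z x).
Proof.
move=> + whi; have [d] := ubnP (len z - len x); elim: d x => // d IH x led lox lm ne.
have [xz zw up dn] := lm.
have [xa az am] := topP xz ne; set a := top z x in xa az am *.
have aw := le_trans az zw.
have lma := local_max_up lm xa az.
have [eaz|naz] := eqVneq a z.
  have ba : bnd <= lam x a by rewrite eaz; apply: dn; rewrite -?eaz.
  split=> //; apply/esym/good_top => // b; rewrite {1}eaz => zb bw.
  by have := up b zb bw; rewrite eaz in ba *; lia.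
have [||e bl] := IH a _ _ lma naz.
- by have := cov_len xa; have := le_len az; clear -led; lia.
- exact: le_trans (cov_le xa).
have [at1 tz tm] := topP az naz.
have lt := top_good xz ne at1 tz.
split; last by rewrite -/a in lt; lia.
apply/esym/good_top => // b ab bw.
have naw : a != w.
  by apply/eqP => eaw; have := le_len bw; rewrite (cov_len ab) -eaw ltnn.
have [_ _ tm'] := topP aw naw.
by apply: leq_ltn_trans (tm' b ab bw) _; rewrite e.
Qed.

Lemma local_max_uniq x w z z' : le lo x -> le w hi ->
  local_max x w z -> local_max x w z' -> z = z'.
Proof.
move=> + whi; have [d] := ubnP (len w - len x); elim: d x => // d IH x led lox lm lm'.
have [xz zw up dn] := lm; have [xz' zw' up' dn'] := lm'.
have [e|ne] := eqVneq x z; have [e'|ne'] := eqVneq x z'; first by rewrite -e -e'.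
- have [e1 b1] := local_max_top lox whi lm' ne'; have [xt tz _] := topP xz' ne'.
  by have := up (top z' x); rewrite -e => /(_ xt (le_trans tz zw')); lia.
- have [e1 b1] := local_max_top lox whi lm ne; have [xt tz _] := topP xz ne.
  by have := up' (top z x); rewrite -e' => /(_ xt (le_trans tz zw)); lia.
have [e1 _] := local_max_top lox whi lm ne; have [xt tz _] := topP xz ne.
have [e2 _] := local_max_top lox whi lm' ne'; have [xt' tz' _] := topP xz' ne'.
have lt := le_len (le_trans tz zw).
apply: (IH (top z x)).
- by rewrite (cov_len xt) in lt *; lia.
- exact: le_trans (cov_le xt).
- exact: local_max_up lm xt tz.
- by apply: local_max_up lm' _ _; rewrite // -e1 e2.
Qed.

End LabelledPoset.

(** * Length, Bruhat covers and lifting *)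

(* Products in ['S_n] are read from left to right: [tperm a b * z] exchanges the values of
   [z] at the positions [a] and [b], while [z * tperm k k'] exchanges two values. *)

Section Length.
Variable n : nat.
Implicit Types (z x y u v w : 'S_n) (a b i j m : 'I_n).

Lemma ord_neq i j : i != j -> (i : nat) <> j.
Proof. by move/eqP => ne e; apply: ne; apply: val_inj. Qed.

Lemma ord_neq_lt i j : (i < j)%N -> i != j.
Proof. by move=> lt; apply/eqP => e; rewrite e ltnn in lt. Qed.

Lemma perm_neq_val z i j : i != j -> (z i : nat) <> z j.
Proof. by move=> ne; apply: ord_neq; rewrite (inj_eq perm_inj). Qed.
Arguments perm_neq_val z {i j}.

Definition inversions z :=
  #|[set p : 'I_n * 'I_n | (p.1 < p.2) && (z p.2 < z p.1)]|.

Lemma tperm_adj_lt a b i j : b = a.+1 :> nat -> i < j -> (i, j) != (a, b) ->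
  tperm a b i < tperm a b j.
Proof.
move=> ab; rewrite xpair_eqE.
by case: tpermP => [->|->|/eqP/ord_neq ? /eqP/ord_neq ?];
  case: tpermP => [->|->|/eqP/ord_neq ? /eqP/ord_neq ?]; rewrite ?eqxx ?andbF //=; lia.
Qed.

Lemma inversions_adj z a b : b = a.+1 :> nat -> z a < z b ->
  inversions (tperm a b * z) = (inversions z).+1.
Proof.
move=> ab zab; pose f (p : 'I_n * 'I_n) := (tperm a b p.1, tperm a b p.2).
have fK : involutive f by case=> i j; rewrite /f /= !tpermK.
set A := [set p : 'I_n * 'I_n | (p.1 < p.2) && (z p.2 < z p.1)].
have -> : inversions (tperm a b * z) = #|(a, b) |: (f @: A)|.
  apply: eq_card => -[i j]; rewrite !inE /= !permM.
  have -> : ((i, j) \in f @: A) = (f (i, j) \in A).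
    by rewrite -{1}(fK (i, j)) mem_imset //; apply: (can_inj fK).
  rewrite !inE /f /=; have [[-> ->]|ne] := eqVneq (i, j) (a, b).
    by rewrite tpermL tpermR zab /=; lia.
  have [ij|ij] /= := ltnP i j; first by rewrite tperm_adj_lt.
  apply/esym/negP => /andP[lt1 lt2].
  have ne' : (tperm a b i, tperm a b j) != (a, b).
    apply/eqP => -[e1 e2]; move: lt2; rewrite e1 e2; lia.
  by have := tperm_adj_lt ab lt1 ne'; rewrite !tpermK; lia.
rewrite cardsU1 card_imset ?add1n; last exact: (can_inj fK).
suff -> : (a, b) \notin f @: A by [].
rewrite -(fK (a, b)) mem_imset; last exact: (can_inj fK).
by rewrite inE /= /f /= tpermL tpermR ab; lia.
Qed.

Lemma monotone_ge z : (forall i j, i < j -> z i < z j) -> forall i, i <= z i.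
Proof.
move=> mono [k lt]; elim: k lt => // k IH lt.
have lt' : k < n by lia.
by apply: leq_ltn_trans (IH lt') (mono (Ordinal lt') (Ordinal lt) _) => /=.
Qed.

Lemma inversions_eq0 z : inversions z = 0 -> z = 1%g.
Proof.
move=> /cards0_eq i0; have mono i j : i < j -> z i < z j.
  move=> ij; have : (i, j) \notin set0 by rewrite inE.
  by rewrite -i0 inE /= ij /= -leqNgt; have := perm_neq_val z (ord_neq_lt ij); lia.
have monoV i j : i < j -> (z^-1)%g i < (z^-1)%g j.
  move=> ij; rewrite ltnNge leq_eqVlt negb_or -leqNgt.
  have := perm_neq_val (z^-1)%g (ord_neq_lt ij) => ne.
  case: ltngtP ne => //= lt _; have := mono _ _ lt; rewrite !permKV; lia.
apply/permP => i; rewrite perm1; apply: val_inj => /=.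
have := monotone_ge mono i; have := monotone_ge monoV (z i); rewrite permK; lia.
Qed.

Lemma descent_ex z : z != 1%g -> exists a b, b = a.+1 :> nat /\ z b < z a.
Proof.
move=> z1; case: (boolP [exists a : 'I_n, exists b : 'I_n, (b == a.+1 :> nat) && (z b < z a)]).
  by case/existsP=> a /existsP[b /andP[/eqP ? ?]]; exists a, b.
rewrite negb_exists => /forallP no; case/eqP: z1.
have asc a b : b = a.+1 :> nat -> z a < z b.
  move=> ab; have := no a; rewrite negb_exists => /forallP/(_ b).
  rewrite ab eqxx /=; have : a != b by apply: ord_neq_lt; rewrite ab.
  by move/(perm_neq_val z); lia.
have mono i j : i < j -> z i < z j.
  have [k] := ubnP (j - i); elim: k j => // k IH j lek ij.
  have [e|ne] := eqVneq (j : nat) i.+1; first exact: asc.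
  have lt : j.-1 < n by have := ltn_ord j; lia.
  apply: ltn_trans (IH (Ordinal lt) _ _) (asc (Ordinal lt) j _) => /=; move/eqP: ne; lia.
apply: inversions_eq0; apply/eqP; rewrite cards_eq0 -subset0; apply/subsetP => -[i j].
by rewrite inE /= => /andP[/mono]; lia.
Qed.

Lemma simple_transP (s : 'S_n) :
  reflect (exists a b, b = a.+1 :> nat /\ s = tperm a b) (s \in simple_transpositions n).
Proof.
apply: (iffP imsetP) => [[[a b]]|[a [b [ab ->]]]].
  by rewrite inE /= => /eqP ab ->; exists a, b.
by exists (a, b) => //; rewrite inE /= ab.
Qed.

Lemma perm_lengthE z : perm_length z = inversions z.
Proof.
have le_inv k u : u \in (simple_transpositions n ^+ k)%g -> inversions u <= k.
  elim: k u => [|k IH] u.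
    rewrite expg0 => /set1P ->; rewrite leqn0 cards_eq0 -subset0.
    by apply/subsetP => -[i j]; rewrite !inE /= !perm1; lia.
  rewrite expgS => /mulsgP[s t /simple_transP[a [b [ab ->]]] /IH le ->].
  have : a != b by apply: ord_neq_lt; rewrite ab.
  move/(perm_neq_val t); case: (ltngtP (t a) (t b)) => // lt _.
    by rewrite inversions_adj.
  have := @inversions_adj (tperm a b * t) a b ab.
  rewrite !permM tpermL tpermR mulgA tperm2 mul1g => /(_ lt) e.
  by rewrite e in le; apply/leqW/ltnW.
rewrite /perm_length; case: ex_minnP => k /le_inv le1 /(_ (inversions z)) le2.
apply/eqP; rewrite eqn_leq le1 le2 //.
clear le1 le2 k; move: {2}(inversions z) (erefl (inversions z)) => k.
elim: k z => [|k IH] z; first by move=> e; rewrite e (inversions_eq0 e) expg0 inE.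
move=> ez; have [e1|/descent_ex[a [b [ab lt]]]] := eqVneq z 1%g.
  have le0 : inversions z <= 0 by apply: le_inv; rewrite e1 expg0 inE.
  by rewrite ez in le0.
have := @inversions_adj (tperm a b * z) a b ab.
rewrite !permM tpermL tpermR mulgA tperm2 mul1g => /(_ lt); rewrite ez => -[ez'].
rewrite expgS -(mulKg (tperm a b) z) tpermV; apply: mem_mulg.
  by apply/simple_transP; exists a, b.
by rewrite {1}ez'; apply: IH.
Qed.

Local Notation len := (@perm_length n).

Lemma len1 : len 1%g = 0.
Proof.
rewrite perm_lengthE; apply/eqP; rewrite cards_eq0 -subset0; apply/subsetP => -[i j].
by rewrite !inE /= !perm1; lia.
Qed.

Lemma len_adj z a b : b = a.+1 :> nat -> z a < z b -> len (tperm a b * z) = (len z).+1.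
Proof. by rewrite !perm_lengthE; apply: inversions_adj. Qed.

Lemma len_adj_desc z a b : b = a.+1 :> nat -> z b < z a -> len z = (len (tperm a b * z)).+1.
Proof.
move=> ab lt; rewrite -(@len_adj _ a b) // ?permM ?tpermL ?tpermR //.
by rewrite mulgA tperm2 mul1g.
Qed.

Definition unblocked z a b := forall m, a < m < b -> ~~ (z a < z m < z b).

Lemma tperm_conj a m b : a != b -> m != b -> a != m ->
  tperm a b = (tperm a m * tperm m b * tperm a m)%g.
Proof.
move=> ab mb am; rewrite -{1}(tpermV a m) -mulgA -conjgE tpermJ tpermR.
by rewrite tpermD.
Qed.

Lemma len_unblocked z a b : a < b -> z a < z b -> unblocked z a b ->
  len (tperm a b * z) = (len z).+1.
Proof.
have [k] := ubnP (b - a); elim: k z a => // k IH z a lek ab zab ub.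
have [e|ne] := eqVneq (b : nat) a.+1; first exact: len_adj.
have lt : a.+1 < n by have := ltn_ord b; move/eqP: ne; lia.
pose m := Ordinal lt; have em : m = a.+1 :> nat by [].
have mb : m < b by rewrite em; move/eqP: ne; lia.
have [nab nmb nam] : [/\ a != b, m != b & a != m].
  by split; apply: ord_neq_lt; rewrite ?em //.
pose x := (tperm a m * z)%g; pose y := (tperm m b * x)%g.
have xa : x a = z m by rewrite permM tpermL.
have xm : x m = z a by rewrite permM tpermR.
have xo c : c != a -> c != m -> x c = z c.
  by move=> ca cm; rewrite permM tpermD // eq_sym.
have xb : x b = z b by rewrite xo // eq_sym.
have ya : y a = z m by rewrite permM tpermD ?xa // eq_sym.
have ym : y m = z b by rewrite permM tpermL xb.
have yE : (tperm a m * y = tperm a b * z)%g.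
  by rewrite (tperm_conj nab nmb nam) /y /x !mulgA.
have ly : len y = (len x).+1.
  apply: IH => //; rewrite ?xm ?xb //; first by rewrite em; lia.
  move=> c /andP[mc cb]; rewrite xm xb xo; first by apply: ub; lia.
    by rewrite eq_sym; apply: ord_neq_lt; lia.
  by rewrite eq_sym; apply: ord_neq_lt.
have := ub m; rewrite em leqnn -em mb => /(_ isT).
have za := perm_neq_val z nam; have zb := perm_neq_val z nmb.
rewrite negb_and -!leqNgt => /orP[le|le].
  have l1 : len z = (len x).+1 by apply: len_adj_desc => //; lia.
  have l2 : len (tperm a m * y) = (len y).+1 by apply: len_adj; rewrite // ya ym; lia.
  by rewrite -yE l2 ly l1.
have l1 : len x = (len z).+1 by apply: len_adj => //; lia.
have l2 : len y = (len (tperm a m * y)).+1 by apply: len_adj_desc; rewrite // ya ym; lia.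
by move: l2; rewrite yE ly l1 => -[].
Qed.

Lemma len_up z a b : a < b -> z a < z b -> len z < len (tperm a b * z).
Proof.
have [k] := ubnP (b - a); elim: k z a b => // k IH z a b lek ab zab.
case: (boolP [exists m : 'I_n, (a < m < b) && (z a < z m < z b)]); last first.
  rewrite negb_exists => /forallP ub; rewrite len_unblocked // => m ab'.
  by have := ub m; rewrite ab'.
case/existsP=> m /andP[/andP[am mb] /andP[zam zmb]].
have [nab nmb nam] : [/\ a != b, m != b & a != m] by split; apply: ord_neq_lt.
rewrite (tperm_conj nab nmb nam) -!mulgA.
apply: ltn_trans (IH z a m _ am zam) _; first by lia.
have lt2 := IH (tperm a m * z)%g m b.
apply: ltn_trans (lt2 _ mb _) _; first by lia.
  by rewrite !permM tpermR tpermD // eq_sym.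
apply: IH => //; first by lia.
by rewrite !permM tpermL (@tpermD _ m b a) ?tpermL ?tpermD // eq_sym.
Qed.

Lemma len_blocked z a b m : a < m < b -> z a < z m < z b ->
  (len z).+2 < len (tperm a b * z).
Proof.
case/andP=> am mb /andP[zam zmb].
have [nab nmb nam] : [/\ a != b, m != b & a != m].
  by split; apply: ord_neq_lt => //; apply: ltn_trans mb.
rewrite (tperm_conj nab nmb nam) -!mulgA.
apply: leq_ltn_trans (len_up am _); last first.
  by rewrite !permM tpermL (@tpermD _ m b a) ?tpermL ?tpermD // eq_sym.
apply: leq_ltn_trans (len_up mb _); last first.
  by rewrite !permM tpermR tpermD //; apply: ltn_trans zam zmb.
exact: len_up.
Qed.

End Length.
Arguments perm_neq_val {n} z {i j}.

Lemma mul_tpermR (T : finType) (x : {perm T}) (a b : T) :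
  (tperm a b * x = x * tperm (x a) (x b))%g.
Proof. by rewrite -tpermJ conjgE !mulgA mulgV mul1g. Qed.

Section Bruhat.
Variable n : nat.
Implicit Types (z x y u v w : 'S_n) (a b i j m : 'I_n).
Local Notation len := (@perm_length n).
Local Notation le := (@bruhat_le n).
Local Notation covers := (cov le len).

Lemma bruhat_stepP x y :
  reflect (exists a b, [/\ a < b, x a < x b & y = tperm a b * x]%g) (bruhat_step x y).
Proof.
apply: (iffP andP) => [[/existsP[i /existsP[j /andP[ij /eqP ->]]] lt]|].
  wlog lt' : i j ij lt / (x^-1)%g i < (x^-1)%g j.
    move=> H; have : (x^-1)%g i != (x^-1)%g j by rewrite (inj_eq perm_inj).
    case: (ltngtP ((x^-1)%g i) ((x^-1)%g j)) => [l|l|/val_inj ->]; last by rewrite eqxx.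
      by move=> _; apply: (H i j).
    by move=> _; rewrite tpermC; apply: (H j i) => //; rewrite 1?eq_sym // tpermC.
  have e : (x * tperm i j = tperm ((x^-1)%g i) ((x^-1)%g j) * x)%g.
    by rewrite mul_tpermR !permKV.
  exists ((x^-1)%g i), ((x^-1)%g j); split=> //.
  rewrite !permKV; move: (ord_neq ij).
  case: ltngtP => // ji _.
  have h : (x * tperm i j)%g ((x^-1)%g i) < (x * tperm i j)%g ((x^-1)%g j).
    by rewrite !permM !permKV tpermL tpermR.
  have := len_up lt' h; rewrite {2}e mulgA tperm2 mul1g.
  by rewrite ltnNge (ltnW lt).
case=> a [b [ab xab ->]]; split; last exact: len_up.
apply/existsP; exists (x a); apply/existsP; exists (x b).
by rewrite mul_tpermR eqxx (inj_eq perm_inj) andbT ord_neq_lt.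
Qed.

Lemma bruhat_le_refl : reflexive le. Proof. by move=> x; apply: connect0. Qed.
Lemma bruhat_le_trans : transitive le. Proof. by move=> y x z; apply: connect_trans. Qed.

Lemma bruhat_le_swap x a b : a < b -> x a < x b -> le x (tperm a b * x)%g.
Proof. by move=> ab xab; apply/connect1/bruhat_stepP; exists a, b. Qed.

Lemma step_len x y : bruhat_step x y -> len x < len y. Proof. by case/andP. Qed.

Lemma bruhat_le_len x y : le x y -> len x <= len y.
Proof.
case/connectP => p; elim: p x => [|z p IH] x /=; first by move=> _ ->.
by case/andP=> /step_len lt /IH/[apply]; lia.
Qed.

Lemma bruhat_le_len_eq x y : le x y -> len y <= len x -> x = y.
Proof.
case/connectP => -[|z p] /=; first by move=> _ ->.
case/andP=> /step_len lt pz ly lyx.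
have : le z y by apply/connectP; exists p.
by move/bruhat_le_len; lia.
Qed.

Lemma bruhat_le_anti x y : le x y -> le y x -> x = y.
Proof. by move=> xy /bruhat_le_len; apply: bruhat_le_len_eq. Qed.

Lemma coverP x y :
  reflect (exists a b, [/\ a < b, x a < x b, unblocked x a b & y = tperm a b * x]%g)
          (covers x y).
Proof.
apply: (iffP andP) => [[/connectP[[|z p] /=]]|].
- by move=> _ -> /eqP; lia.
- case/andP=> xz pz ly /eqP l.
  have zy : le z y by apply/connectP; exists p.
  have lz := step_len xz; have ezy : z = y by apply: bruhat_le_len_eq => //; lia.
  case/bruhat_stepP: xz => a [b [ab xab ez]]; exists a, b; split; rewrite -?ezy //.
  move=> m mab; apply/negP => mb.
  by have := len_blocked mab mb; rewrite -ez ezy l; lia.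
case=> a [b [ab xab ub ->]]; split; first exact: bruhat_le_swap.
by rewrite len_unblocked.
Qed.

Lemma atom_ex x y : le x y -> x != y -> exists2 a, covers x a & le a y.
Proof.
case/connectP => -[|z p] /=; first by move=> _ ->; rewrite eqxx.
case/andP=> xz pz ly _; have zy : le z y by apply/connectP; exists p.
suff [a xa az] : exists2 a, covers x a & le a z by exists a => //; apply: bruhat_le_trans az zy.
clear p pz ly zy; case/bruhat_stepP: xz => a [b [ab xab ->]].
have [k] := ubnP (b - a); elim: k b ab xab => // k IH b lek ab xab.
case: (boolP [exists m : 'I_n, (a < m < b) && (x a < x m < x b)]); last first.
  rewrite negb_exists => /forallP ub; exists (tperm a b * x)%g; last exact: bruhat_le_refl.
  apply/coverP; exists a, b; split=> // m ab'.
  by have := ub m; rewrite ab'.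
case/existsP=> m /andP[/andP[am mb] /andP[xam xmb]].
have [c xc cz] := IH m am xam ltac:(lia).
exists c => //; apply: bruhat_le_trans cz _.
have [nab nmb nam] : [/\ a != b, m != b & a != m] by split; apply: ord_neq_lt.
rewrite (tperm_conj nab nmb nam) -!mulgA.
apply: (@bruhat_le_trans (tperm m b * (tperm a m * x))%g).
  by apply: bruhat_le_swap => //; rewrite !permM tpermR tpermD // 1?eq_sym.
by apply: bruhat_le_swap => //; rewrite !permM tpermL (@tpermD _ m b a) ?tpermL ?tpermD // eq_sym.
Qed.

Section Lifting.
Variables k k' : 'I_n.
Hypothesis kS : k' = k.+1 :> nat.
Local Notation s := (tperm k k').

Definition desc x := (x^-1)%g k' < (x^-1)%g k.
Definition hi_lift x := if desc x then x else (x * s)%g.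
Definition lo_lift x := if desc x then (x * s)%g else x.

Lemma mul_ss x : (x * s * s)%g = x.
Proof. by rewrite -mulgA tperm2 mulg1. Qed.

Lemma descM x : desc (x * s)%g = ~~ desc x.
Proof.
rewrite /desc invMg tpermV !permM tpermL tpermR.
have ne : k != k' by apply: ord_neq_lt; rewrite kS.
by have := perm_neq_val (x^-1)%g ne; case: ltngtP.
Qed.

Lemma cover_asc x : ~~ desc x -> covers x (x * s)%g.
Proof.
rewrite -descM /desc invMg tpermV !permM tpermL tpermR => lt.
apply/coverP; exists ((x^-1)%g k), ((x^-1)%g k'); split=> //.
- by rewrite !permKV kS.
- by move=> m _; rewrite !permKV kS; lia.
- by rewrite mul_tpermR !permKV.
Qed.

Lemma cover_desc x : desc x -> covers (x * s)%g x.
Proof. by move=> d; rewrite -{2}(mul_ss x) cover_asc // descM d. Qed.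

Lemma step_mul_s x y : bruhat_step x y -> y = (x * s)%g \/ bruhat_step (x * s)%g (y * s)%g.
Proof.
case/bruhat_stepP=> a [b [ab xab ->]].
have [[ea eb]|ne] := eqVneq (x a, x b) (k, k').
  by left; rewrite mul_tpermR ea eb.
right; apply/bruhat_stepP; exists a, b; split=> //; last by rewrite mulgA.
by rewrite !permM tperm_adj_lt.
Qed.

Lemma le_hi_lift x : le x (hi_lift x) /\ le (x * s)%g (hi_lift x).
Proof.
rewrite /hi_lift; case: ifPn => d; split; rewrite ?bruhat_le_refl //.
  exact/cov_le/cover_desc.
exact/cov_le/cover_asc.
Qed.

Lemma ge_lo_lift x : le (lo_lift x) x /\ le (lo_lift x) (x * s)%g.
Proof.
rewrite /lo_lift; case: ifPn => d; split; rewrite ?bruhat_le_refl //.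
  exact/cov_le/cover_desc.
exact/cov_le/cover_asc.
Qed.

Lemma hi_lift_mono x y : le x y -> le (hi_lift x) (hi_lift y).
Proof.
case/connectP=> p; elim: p x => [|z p IH] x /=; first by move=> _ ->; apply: bruhat_le_refl.
case/andP=> xz /IH/[apply]; apply: bruhat_le_trans.
case: (step_mul_s xz) => [->|xz'].
  by rewrite /hi_lift descM if_neg; case: ifP; rewrite ?mul_ss bruhat_le_refl.
have [h1 h2] := le_hi_lift z.
rewrite {1}/hi_lift; case: ifP => _; first exact: bruhat_le_trans (connect1 xz) h1.
exact: bruhat_le_trans (connect1 xz') h2.
Qed.

Lemma lo_lift_mono x y : le x y -> le (lo_lift x) (lo_lift y).
Proof.
case/connectP=> p; elim: p x => [|z p IH] x /=; first by move=> _ ->; apply: bruhat_le_refl.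
case/andP=> xz /IH/[apply]; apply: bruhat_le_trans.
case: (step_mul_s xz) => [->|xz'].
  by rewrite /lo_lift descM if_neg; case: ifP; rewrite ?mul_ss bruhat_le_refl.
have [h1 h2] := ge_lo_lift x.
rewrite {2}/lo_lift; case: ifP => _; first exact: bruhat_le_trans h2 (connect1 xz').
exact: bruhat_le_trans h1 (connect1 xz).
Qed.

End Lifting.
End Bruhat.

Section Flip.
Variable n : nat.
Implicit Types (z x y u v w : 'S_n) (a b i j m p q r : 'I_n).
Local Notation len := (@perm_length n).
Local Notation le := (@bruhat_le n).
Local Notation covers := (cov le len).

Lemma tperm3 (T : finType) (p q r : T) : p != q -> q != r -> p != r ->
  [/\ tperm p q * tperm q r = tperm p r * tperm p q,
      tperm q r * tperm p r = tperm p r * tperm p q,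
      tperm q r * tperm p q = tperm p q * tperm p r &
      tperm p r * tperm q r = tperm p q * tperm p r]%g.
Proof.
move=> pq qr pr; have e1 : (tperm p q * tperm q r = tperm q r * tperm p r)%g.
  by rewrite mul_tpermR tpermL tpermD // eq_sym.
have e2 : (tperm q r * tperm p r = tperm p r * tperm p q)%g.
  by rewrite mul_tpermR tpermR tpermD ?(tpermC q) // eq_sym.
split; rewrite ?e1 ?e2 //; apply: invg_inj; rewrite !invMg !tpermV.
  by rewrite e1.
by rewrite e2.
Qed.

Definition cover_at x a b := [/\ a < b, x a < x b & unblocked x a b].

Lemma cover_at_covers x a b : cover_at x a b -> covers x (tperm a b * x)%g.
Proof. by case=> ab xab ub; apply/coverP; exists a, b. Qed.

Section Triple.
Variables (x : 'S_n) (p q r : 'I_n).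
Hypothesis (pq : p < q) (qr : q < r).

Let nepq : p != q. Proof. exact: ord_neq_lt. Qed.
Let neqr : q != r. Proof. exact: ord_neq_lt. Qed.
Let nepr : p != r. Proof. by apply: ord_neq_lt; apply: ltn_trans qr. Qed.
Let neqp : q != p. Proof. by rewrite eq_sym. Qed.
Let nerq : r != q. Proof. by rewrite eq_sym. Qed.
Let nerp : r != p. Proof. by rewrite eq_sym. Qed.

Lemma swap3E :
  ((tperm p q * x)%g p = x q) * ((tperm p q * x)%g q = x p) * ((tperm p q * x)%g r = x r) *
  ((tperm q r * x)%g p = x p) * ((tperm q r * x)%g q = x r) * ((tperm q r * x)%g r = x q) *
  ((tperm p r * x)%g p = x r) * ((tperm p r * x)%g q = x q) * ((tperm p r * x)%g r = x p).
Proof. by do !split; rewrite permM ?tpermL ?tpermR ?tpermD. Qed.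

Lemma swap3O m : m != p -> m != q -> m != r ->
  ((tperm p q * x)%g m = x m) * ((tperm q r * x)%g m = x m) * ((tperm p r * x)%g m = x m).
Proof. by move=> mp mq mr; do !split; rewrite permM tpermD // eq_sym. Qed.

End Triple.

Ltac cover3 x p q r pq qr u1 u2 :=
  let m := fresh "m" in let mb := fresh "mb" in
  let e := fresh "e" in let h1 := fresh "h1" in let h2 := fresh "h2" in
  let mp := fresh "mp" in let mq := fresh "mq" in let mr := fresh "mr" in
  rewrite /cover_at ?(swap3E x pq qr);
  have := u1 q; have := u2 q; rewrite ?(swap3E x pq qr); move=> h1 h2;
  split; [ lia | lia | move=> m mb;
  have [e|mp] := eqVneq m p; [rewrite e in mb; lia|];
  have [e|mr] := eqVneq m r; [rewrite e in mb; lia|];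
  have [e|mq] := eqVneq m q;
    [ rewrite e ?(swap3E x pq qr); try lia
    | have := u1 m; have := u2 m; have := ord_neq mq;
      have := perm_neq_val x mq; have := perm_neq_val x mp; have := perm_neq_val x mr;
      rewrite ?(swap3E x pq qr) !(swap3O x mp mq mr); lia ] ].

(* The four rank-two intervals of S_3, at the positions [p < q < r], each read from either
   of its two chains. *)
Lemma cover3_1 x p q r : p < q -> q < r -> x q < x r ->
  cover_at x p q -> cover_at (tperm p q * x)%g q r ->
  cover_at x q r /\ cover_at (tperm q r * x)%g p r.
Proof.
move=> pq qr xqr [_ l1 u1] [_ l2 u2]; rewrite ?(swap3E x pq qr) in l2.
split; cover3 x p q r pq qr u1 u2.
Qed.

Lemma cover3_1' x p q r : p < q -> q < r ->
  cover_at x q r -> cover_at (tperm q r * x)%g p r ->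
  cover_at x p q /\ cover_at (tperm p q * x)%g q r.
Proof.
move=> pq qr [_ l1 u1] [_ l2 u2]; rewrite ?(swap3E x pq qr) in l2.
split; cover3 x p q r pq qr u1 u2.
Qed.

Lemma cover3_2 x p q r : p < q -> q < r -> x p < x q ->
  cover_at x q r -> cover_at (tperm q r * x)%g p q ->
  cover_at x p q /\ cover_at (tperm p q * x)%g p r.
Proof.
move=> pq qr xpq [_ l1 u1] [_ l2 u2]; rewrite ?(swap3E x pq qr) in l2.
split; cover3 x p q r pq qr u1 u2.
Qed.

Lemma cover3_2' x p q r : p < q -> q < r ->
  cover_at x p q -> cover_at (tperm p q * x)%g p r ->
  cover_at x q r /\ cover_at (tperm q r * x)%g p q.
Proof.
move=> pq qr [_ l1 u1] [_ l2 u2]; rewrite ?(swap3E x pq qr) in l2.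
split; cover3 x p q r pq qr u1 u2.
Qed.

Lemma cover3_3 x p q r : p < q -> q < r -> x r < x q ->
  cover_at x p q -> cover_at (tperm p q * x)%g q r ->
  cover_at x p r /\ cover_at (tperm p r * x)%g p q.
Proof.
move=> pq qr xrq [_ l1 u1] [_ l2 u2]; rewrite ?(swap3E x pq qr) in l2.
split; cover3 x p q r pq qr u1 u2.
Qed.

Lemma cover3_3' x p q r : p < q -> q < r ->
  cover_at x p r -> cover_at (tperm p r * x)%g p q ->
  cover_at x p q /\ cover_at (tperm p q * x)%g q r.
Proof.
move=> pq qr [_ l1 u1] [_ l2 u2]; rewrite ?(swap3E x pq qr) in l2.
split; cover3 x p q r pq qr u1 u2.
Qed.

Lemma cover3_4 x p q r : p < q -> q < r -> x q < x p ->
  cover_at x q r -> cover_at (tperm q r * x)%g p q ->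
  cover_at x p r /\ cover_at (tperm p r * x)%g q r.
Proof.
move=> pq qr xqp [_ l1 u1] [_ l2 u2]; rewrite ?(swap3E x pq qr) in l2.
split; cover3 x p q r pq qr u1 u2.
Qed.

Lemma cover3_4' x p q r : p < q -> q < r ->
  cover_at x p r -> cover_at (tperm p r * x)%g q r ->
  cover_at x q r /\ cover_at (tperm q r * x)%g p q.
Proof.
move=> pq qr [_ l1 u1] [_ l2 u2]; rewrite ?(swap3E x pq qr) in l2.
split; cover3 x p q r pq qr u1 u2.
Qed.

Lemma swapO x i j m : m != i -> m != j -> (tperm i j * x)%g m = x m.
Proof. by move=> mi mj; rewrite permM tpermD // eq_sym. Qed.

Lemma swapL x i j : (tperm i j * x)%g i = x j. Proof. by rewrite permM tpermL. Qed.
Lemma swapR x i j : (tperm i j * x)%g j = x i. Proof. by rewrite permM tpermR. Qed.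

Lemma cover_disjoint x i j k l : i != k -> i != l -> j != k -> j != l ->
  cover_at x i j -> cover_at (tperm i j * x)%g k l ->
  cover_at x k l /\ cover_at (tperm k l * x)%g i j.
Proof.
move=> ik il jk jl [ij l1 u1] [kl l2 u2].
have [ki li kj lj] : [/\ k != i, l != i, k != j & l != j] by rewrite !(eq_sym _ i) !(eq_sym _ j).
rewrite !swapO // in l2.
have := u1 k; have := u1 l; have := u2 i; have := u2 j; rewrite swapL swapR !swapO // => h1 h2 h3 h4.
have nik := perm_neq_val x ik; have nil := perm_neq_val x il.
have njk := perm_neq_val x jk; have njl := perm_neq_val x jl.
move: (ord_neq ik) (ord_neq il) (ord_neq jk) (ord_neq jl) => oik oil ojk ojl.
split; split; rewrite ?swapO // => m mb.
  have [e|mi] := eqVneq m i; first by rewrite e in mb *; lia.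
  have [e|mj] := eqVneq m j; first by rewrite e in mb *; lia.
  by have := u2 m mb; rewrite !swapO.
have [e|mk] := eqVneq m k; first by rewrite e in mb *; rewrite swapL !swapO //; lia.
have [e|ml] := eqVneq m l; first by rewrite e in mb *; rewrite swapR !swapO //; lia.
by rewrite !swapO //; apply: u1.
Qed.

Definition between (key : 'I_n -> 'I_n -> nat) := forall p q r, p < q -> q < r ->
  (key p q < key p r < key q r) || (key q r < key p r < key p q).

Lemma flip_cover x i j k l : cover_at x i j -> cover_at (tperm i j * x)%g k l ->
  exists i' j' k' l', [/\ cover_at x i' j', cover_at (tperm i' j' * x)%g k' l',
    (tperm k l * (tperm i j * x) = tperm k' l' * (tperm i' j' * x))%g,
    (i', j') != (i, j)
    & forall key, between key -> key i j < key k l -> key i j < key i' j'].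
Proof.
move=> c1 c2; have [ij xij u1] := c1; have [kl akl u2] := c2.
have neq a b c d : (a, b) != (c, d) = (a != c) || (b != d) by rewrite xpair_eqE negb_and.
have lt_or a b (f : 'I_n -> nat) : a != b -> f a != f b -> f a < f b \/ f b < f a.
  by move=> _; case: ltngtP => //; [left | right].
have vneq a b : a != b -> x a != x b :> nat by move/(perm_neq_val x)/eqP.
have [eki|nki] := eqVneq k i; last have [ekj|nkj] := eqVneq k j;
  last have [eli|nli] := eqVneq l i; last have [elj|nlj] := eqVneq l j.
- subst k; have [elj|nlj] := eqVneq l j; first by move: akl; rewrite elj swapL swapR; lia.
  have [lj|jl] := lt_or l j val nlj nlj; [have il := kl | have il := ltn_trans ij jl].
    have [t1 t2 t3 t4] := tperm3 (ord_neq_lt il) (ord_neq_lt lj) (ord_neq_lt ij).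
    have [d1 d2] := cover3_3' il lj c1 c2.
    exists i, l, l, j; split=> //; first by rewrite !mulgA t3.
    by rewrite neq nlj orbT.
  have [t1 t2 t3 t4] := tperm3 (ord_neq_lt ij) (ord_neq_lt jl) (ord_neq_lt il).
  have [d1 d2] := cover3_2' ij jl c1 c2.
  exists j, l, i, j; split=> //; first by rewrite !mulgA t1.
    by rewrite neq eq_sym ord_neq_lt.
  by move=> key /(_ i j l ij jl); lia.
- subst k; have il := ltn_trans ij kl.
  have [t1 t2 t3 t4] := tperm3 (ord_neq_lt ij) (ord_neq_lt kl) (ord_neq_lt il).
  have [jl|lj] := lt_or j l (fun c => x c : nat) (ord_neq_lt kl) (vneq _ _ (ord_neq_lt kl)).
    have [d1 d2] := cover3_1 ij kl jl c1 c2.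
    exists j, l, i, l; split=> //; first by rewrite !mulgA t3 t4.
    by rewrite neq eq_sym ord_neq_lt.
  have [d1 d2] := cover3_3 ij kl lj c1 c2.
  exists i, l, i, j; split=> //; first by rewrite !mulgA t3.
    by rewrite neq orbC eq_sym ord_neq_lt.
  by move=> key /(_ i j l ij kl); lia.
- subst l; have kj := ltn_trans kl ij.
  have [t1 t2 t3 t4] := tperm3 (ord_neq_lt kl) (ord_neq_lt ij) (ord_neq_lt kj).
  have [ki|ik] := lt_or k i (fun c => x c : nat) (ord_neq_lt kl) (vneq _ _ (ord_neq_lt kl)).
    have [d1 d2] := cover3_2 kl ij ki c1 c2.
    exists k, i, k, j; split=> //; first by rewrite !mulgA t1.
    by rewrite neq ord_neq_lt.
  have [d1 d2] := cover3_4 kl ij ik c1 c2.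
  exists k, j, i, j; split=> //; first by rewrite !mulgA t1 t2.
    by rewrite neq ord_neq_lt.
  by move=> key /(_ k i j kl ij); lia.
- subst l; have [ki|ik] := lt_or k i val nki nki.
    have [t1 t2 t3 t4] := tperm3 (ord_neq_lt ki) (ord_neq_lt ij) (ord_neq_lt kl).
    have [d1 d2] := cover3_1' ki ij c1 c2.
    exists k, i, i, j; split=> //; first by rewrite !mulgA t4 t3.
      by rewrite neq nki.
    by move=> key /(_ k i j ki ij); lia.
  have [t1 t2 t3 t4] := tperm3 (ord_neq_lt ik) (ord_neq_lt kl) (ord_neq_lt ij).
  have [d1 d2] := cover3_4' ik kl c1 c2.
  exists k, j, i, k; split=> //; first by rewrite !mulgA t2 t1.
  by rewrite neq nki.
have [d1 d2] : cover_at x k l /\ cover_at (tperm k l * x)%g i j.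
  by apply: cover_disjoint => //; rewrite eq_sym.
exists k, l, i, j; split=> //; last by rewrite neq nki.
by rewrite !mulgA mul_tpermR !tpermD // eq_sym.
Qed.

Lemma tperm_lt_inj (i j k l : 'I_n) : i < j -> k < l -> tperm i j = tperm k l -> (i, j) = (k, l).
Proof.
move=> ij kl e; have := congr1 (fun p : 'S_n => p i) e; rewrite /= tpermL.
case: tpermP => [-> ->//|ei e'|_ _ e']; first by move: ij; rewrite ei e'; lia.
by move: ij; rewrite e' ltnn.
Qed.

Lemma other_middle x (a b : 'S_n) : covers x a -> covers a b ->
  exists2 a' : 'S_n, a' != a & covers x a' /\ covers a' b.
Proof.
case/coverP=> i [j [ij xij u1 ->]] /coverP[k [l [kl xkl u2 ->]]].
have c1 : cover_at x i j by [].
have [i' [j' [k' [l' [d1 d2 -> ne _]]]]] := flip_cover c1 (And3 kl xkl u2).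
exists (tperm i' j' * x)%g; last by split; apply: cover_at_covers.
have [[ij' _ _] ne'] := (d1, ne); apply: contra ne' => /eqP/mulIg.
by move/(tperm_lt_inj ij' ij) ->.
Qed.

End Flip.

Section Connectivity.
Variable n : nat.
Implicit Types (v w x y a b : 'S_n).
Local Notation len := (@perm_length n).
Local Notation le := (@bruhat_le n).
Local Notation covers := (cov le len).
Local Notation linked := (adj le len).

Lemma covers_le x y : covers x y -> le x y. Proof. exact: cov_le. Qed.

Lemma linkedI v w a a' b : covers v a -> covers v a' -> covers a b -> covers a' b -> le b w ->
  connect (linked v w) a a'.
Proof.
move=> va va' ab ab' bw; apply: connect1; rewrite /adj va va' /=.
by apply/existsP; exists b; rewrite ab ab'.
Qed.

Lemma linked_sym v w : connect_sym (linked v w).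
Proof.
apply: sym_connect_sym => a a'; rewrite /adj andbCA; do 2!congr (_ && _).
by apply: eq_existsb => b; rewrite andbCA.
Qed.

Lemma linked_sub v w w' : le w w' -> subrel (connect (linked v w)) (connect (linked v w')).
Proof.
move=> ww'; apply: connect_sub => a a' /and3P[va va' /existsP[b /and3P[ab ab' bw]]].
exact: linkedI va va' ab ab' (bruhat_le_trans bw ww').
Qed.

Lemma cover_intro x y : le x y -> len y = (len x).+1 -> covers x y.
Proof. by move=> xy e; rewrite /cov /= xy e eqxx. Qed.

(* Take a simple reflection [s] exchanging two values such that [ws < w] ([*] as in
   ['S_n]).  If [vs > v], every atom is linked to [vs]; otherwise compare with the interval
   [[vs, ws]], where [ws] is shorter than [w]. *)
Lemma atoms_connected v w a a' : covers v a -> le a w -> covers v a' -> le a' w ->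
  connect (linked v w) a a'.
Proof.
have [d] := ubnP (len w); elim: d v w a a' => // d IH v w a a' ld va aw va' aw'.
have [ew|/descent_ex[k [k' [kS kd]]]] := eqVneq (w^-1)%g 1%g.
  have e : w = 1%g by rewrite -(invgK w) ew invg1.
  by have := bruhat_le_len aw; rewrite (cov_len va) e len1.
pose s := tperm k k'.
have dw : desc k k' w by [].
have lws : len w = (len (w * s)%g).+1 by apply/cov_len/cover_desc.
have wsw : le (w * s)%g w by apply/cov_le/cover_desc.
have up x : le x w -> ~~ desc k k' x -> le (x * s)%g w.
  by move=> /(hi_lift_mono kS); rewrite /hi_lift dw => h /negbTE e; rewrite e in h.
have up_le x y : le x y -> ~~ desc k k' x -> desc k k' y -> le (x * s)%g y.
  by move=> /(hi_lift_mono kS); rewrite /hi_lift => h /negbTE e1 e2; rewrite e1 e2 in h.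
have up2 x y : le x y -> ~~ desc k k' x -> ~~ desc k k' y -> le (x * s)%g (y * s)%g.
  move=> /(hi_lift_mono kS); rewrite /hi_lift => h /negbTE e1 /negbTE e2.
  by rewrite e1 e2 in h.
have lasc x : ~~ desc k k' x -> len (x * s)%g = (len x).+1.
  by move=> /(cover_asc kS)/cov_len.
have ldesc x : desc k k' x -> len x = (len (x * s)%g).+1.
  by move=> /(cover_desc kS)/cov_len.
have lo x : le x w -> ~~ desc k k' x -> le x (w * s)%g.
  by move=> /(lo_lift_mono kS); rewrite /lo_lift dw => h /negbTE e; rewrite e in h.
have lo2 x y : le x y -> desc k k' x -> desc k k' y -> le (x * s)%g (y * s)%g.
  by move=> /(lo_lift_mono kS); rewrite /lo_lift => h e1 e2; rewrite e1 e2 in h.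
case: (boolP (desc k k' v)) => dv; last first.
  have star b : covers v b -> le b w -> connect (linked v w) b (v * s)%g.
    move=> vb bw; case: (boolP (desc k k' b)) => db.
      suff -> : (v * s)%g = b by [].
      by apply: bruhat_le_len_eq; [apply: up_le => //; apply: covers_le | rewrite (cov_len vb) lasc].
    apply: (@linkedI _ _ _ _ (b * s)%g) => //.
    - exact: cover_asc.
    - exact: cover_asc.
    - apply: cover_intro; first by apply: up2 => //; apply: covers_le.
      by rewrite !lasc // (cov_len vb).
    - exact: up.
  by apply: connect_trans (star a va aw) _; rewrite linked_sym; apply: star.
have asc_atom b : covers v b -> le b w -> ~~ desc k k' b ->
    exists e, [/\ covers (v * s)%g e, e != v, ~~ desc k k' e, le e b &
                  connect (linked v w) b (e * s)%g].
  move=> vb bw db; have [e ne [ve eb]] := other_middle (cover_desc kS dv) vb.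
  have de : ~~ desc k k' e.
    apply/negP => de; case/negP: ne; apply/eqP/esym/bruhat_le_len_eq.
      have := up_le _ _ (cov_le ve); rewrite descM // dv /= => /(_ isT de).
      by rewrite mul_ss.
    by rewrite (cov_len ve) (ldesc v dv).
  exists e; split=> //; first exact: covers_le.
  apply: (@linkedI _ _ _ _ (b * s)%g) => //.
  - apply: cover_intro.
      have := up2 _ _ (cov_le ve); rewrite descM // dv /= => /(_ isT de).
      by rewrite mul_ss.
    by rewrite lasc // (cov_len ve) -(ldesc v dv).
  - exact: cover_asc.
  - apply: cover_intro; first by apply: up2 => //; apply: covers_le.
    by rewrite !lasc // (cov_len eb).
  - exact: up.
have lift_atom e : covers (v * s)%g e -> le e (w * s)%g -> e != v ->
    ~~ desc k k' e /\ covers v (e * s)%g.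
  move=> ve ew ne; have de : ~~ desc k k' e.
    apply/negP => de; case/negP: ne; apply/eqP/esym/bruhat_le_len_eq.
      have := up_le _ _ (cov_le ve); rewrite descM // dv /= => /(_ isT de).
      by rewrite mul_ss.
    by rewrite (cov_len ve) (ldesc v dv).
  split=> //; apply: cover_intro; last by rewrite lasc // (cov_len ve) -(ldesc v dv).
  have := up2 _ _ (cov_le ve); rewrite descM // dv /= => /(_ isT de).
  by rewrite mul_ss.
have to_low b : covers v b -> le b w ->
    exists e, [/\ covers (v * s)%g e, le e (w * s)%g, e != v
                & connect (linked v w) b (e * s)%g].
  move=> vb bw; case: (boolP (desc k k' b)) => db.
    exists (b * s)%g; rewrite mul_ss; split=> //.
    - apply: cover_intro; first by apply: lo2 => //; apply: covers_le.
      by apply: succn_inj; rewrite -(ldesc b db) -(ldesc v dv) (cov_len vb).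
    - exact: lo2.
    - by apply/eqP => e; have := descM kS b; rewrite e dv db.
  have [e [ve ne de eb c]] := asc_atom b vb bw db.
  by exists e; split=> //; apply: bruhat_le_trans eb (lo _ bw db).
have [e [ve ew ne c]] := to_low a va aw.
have [e' [ve' ew' ne' c']] := to_low a' va' aw'.
apply: connect_trans c _; rewrite linked_sym; apply: connect_trans c' _.
have : connect (linked (v * s)%g (w * s)%g) e' e by apply: IH => //; rewrite -lws.
(* [v] itself may be an atom of [[vs, ws]]; it is then replaced by an atom of [[v, ws]]. *)
have [c0 c0P] : exists c0, le v (w * s)%g -> v != (w * s)%g ->
    covers v c0 /\ le c0 (w * s)%g.
  have [vw|] := boolP (le v (w * s)%g); last by exists v.
  have [<-|nvw] := eqVneq v (w * s)%g; first by exists v.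
  by have [c0 vc cw] := atom_ex vw nvw; exists c0.
pose rep x := if x == v then c0 else (x * s)%g.
have step x x' : linked (v * s)%g (w * s)%g x x' -> connect (linked v w) (rep x) (rep x').
  have near_v y b : covers (v * s)%g y -> y != v -> covers y b -> covers v b ->
      le b (w * s)%g -> connect (linked v w) (y * s)%g c0.
    move=> vy ny yb vb bw; have yw := bruhat_le_trans (cov_le yb) bw.
    have [dy vys] := lift_atom y vy yw ny.
    have vw := bruhat_le_trans (cov_le vb) bw.
    have nvw : v != (w * s)%g.
      by apply/eqP => e0; have := bruhat_le_len bw; rewrite (cov_len vb) e0 ltnn.
    have [vc cw] := c0P vw nvw.
    apply: (@connect_trans _ _ b); last first.
      by apply: (linked_sub wsw); apply: IH => //; rewrite -lws.
    case: (boolP (desc k k' b)) => db.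
      suff -> : (y * s)%g = b by [].
      apply: bruhat_le_len_eq; first by apply: up_le => //; apply: covers_le.
      by rewrite (cov_len yb) lasc.
    apply: (@linkedI _ _ _ _ (b * s)%g) => //.
    - apply: cover_intro; first by apply: up2 => //; apply: covers_le.
      by rewrite !lasc // (cov_len yb).
    - exact: cover_asc.
    - by apply: up => //; apply: bruhat_le_trans bw wsw.
  case/and3P=> vx vx' /existsP[b /and3P[xb xb' bw]].
  have xw := bruhat_le_trans (cov_le xb) bw; have xw' := bruhat_le_trans (cov_le xb') bw.
  rewrite /rep; have [exv|nx] := eqVneq x v; have [exv'|nx'] := eqVneq x' v => //.
  - by rewrite linked_sym; apply: (near_v x' b) => //; rewrite -exv.
  - by apply: (near_v x b) => //; rewrite -exv'.
  have [dx vxs] := lift_atom x vx xw nx; have [dx' vxs'] := lift_atom x' vx' xw' nx'.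
  case: (boolP (desc k k' b)) => db.
    have -> : (x * s)%g = b.
      by apply: bruhat_le_len_eq; [apply: up_le => //; apply: covers_le | rewrite (cov_len xb) lasc].
    suff -> : (x' * s)%g = b by [].
    by apply: bruhat_le_len_eq; [apply: up_le => //; apply: covers_le | rewrite (cov_len xb') lasc].
  apply: (@linkedI _ _ _ _ (b * s)%g) => //.
  - apply: cover_intro; first by apply: up2 => //; apply: covers_le.
    by rewrite !lasc // (cov_len xb).
  - apply: cover_intro; first by apply: up2 => //; apply: covers_le.
    by rewrite !lasc // (cov_len xb').
  - by apply: up => //; apply: bruhat_le_trans bw wsw.
have re : rep e = (e * s)%g by rewrite /rep (negbTE ne).
have re' : rep e' = (e' * s)%g by rewrite /rep (negbTE ne').
rewrite -re -re' => /connectP[p pP ->].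
elim: p e' pP {ne' ve' ew' re'} => //= x p IHp e' /andP[/step st pP].
exact: connect_trans st (IHp _ pP).
Qed.

End Connectivity.

(** * Uniqueness of short descending chains *)

(* A cover swapping the positions [a < b] is positive if the priority [ra] of [a] exceeds
   the priority [rb] of [b].  Positive covers are above the others; among positive ones a
   smaller [b] is larger, among the others a larger [b] is larger, and ties are broken by
   [ra].  This is the order of the slopes (c_a - c_b) / (K^b - K^a) for [K] large, where [c]
   is a functional inducing the priorities: descending chains trace the upper boundary of a
   planar projection of the polytope. *)
Definition klex (b ra rb b' ra' rb' : nat) : bool :=
  if rb < ra then if rb' < ra' then if b == b' then ra < ra' else b' < b else false
  else if rb' < ra' then true else if b == b' then ra < ra' else b < b'.

Definition pattern_swap (u : seq nat) (p : nat * nat) : seq nat :=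
  mkseq (fun t => nth 0 u (if t == p.1 then p.2 else if t == p.2 then p.1 else t)) (size u).

Definition pattern_cover (u : seq nat) (p : nat * nat) : bool :=
  if (p.1 < p.2) && (nth 0 u p.1 < nth 0 u p.2) then
    all (fun m => ~~ ((p.1 < m < p.2) && (nth 0 u p.1 < nth 0 u m < nth 0 u p.2)))
        (iota 0 (size u))
  else false.

Definition pattern_lt (cr : seq nat) (p q : nat * nat) : bool :=
  klex p.2 (nth 0 cr p.1) (nth 0 cr p.2) q.2 (nth 0 cr q.1) (nth 0 cr q.2).

Definition pairs (k : nat) : seq (nat * nat) := [seq (i, j) | i <- iota 0 k, j <- iota 0 k].

Fixpoint pattern_chains (r : nat) (u : seq nat) : seq (seq (nat * nat) * seq nat) :=
  if r is r'.+1 then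
    [seq (p :: c.1, c.2) | p <- filter (pattern_cover u) (pairs (size u)),
                           c <- pattern_chains r' (pattern_swap u p)]
  else [:: ([::], u)].

Definition pattern_desc (cr : seq nat) (c : seq (nat * nat)) : bool :=
  sorted (fun p q => pattern_lt cr q p) c.

(* Any two chains of length [r] in S_k with equal ends that are descending for a common
   priority order have the same first label.  It suffices to treat chains whose product of
   swaps moves all [k] positions, which keeps the computation small. *)
Definition pattern_check (k r : nat) : bool :=
  let crs := permutations (iota 0 k) in
  all (fun u =>
    let cs := filter (fun c => all (fun t => nth 0 u t != nth 0 c.2 t) (iota 0 k))
                     (pattern_chains r u) in
    all (fun c => all (fun d =>
      if (c.2 != d.2) || (ohead c.1 == ohead d.1) then true else
      all (fun cr => if pattern_desc cr c.1 then ~~ pattern_desc cr d.1 else true) crs)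
      cs) cs) crs.

Lemma pattern_check2 k : k <= 4 -> pattern_check k 2.
Proof.
have h : all (fun k => pattern_check k 2) (iota 0 5) by vm_cast_no_check (erefl true).
by move=> k4; apply: (allP h); rewrite mem_iota.
Qed.

Lemma pattern_check3 k : k <= 5 -> pattern_check k 3.
Proof.
have h : all (fun k => pattern_check k 3) (iota 0 6) by vm_cast_no_check (erefl true).
by move=> k5; apply: (allP h); rewrite mem_iota.
Qed.

Section Flatten.
Variable n : nat.
Implicit Types (x y z : 'S_n) (a b c i j m : 'I_n) (ls : seq ('I_n * 'I_n)).

Fixpoint chain z ls : Prop :=
  if ls is p :: ls' then cover_at z p.1 p.2 /\ chain (tperm p.1 p.2 * z)%g ls' else True.

Fixpoint chain_end z ls : 'S_n :=
  if ls is p :: ls' then chain_end (tperm p.1 p.2 * z)%g ls' else z.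

Variable I : {set 'I_n}.
Local Notation ps := (enum I).

Definition idx a := index a ps.
Definition idx2 (p : 'I_n * 'I_n) := (idx p.1, idx p.2).

Lemma idx_lt a b : a \in I -> b \in I -> (idx a < idx b) = (a < b).
Proof.
move=> aI bI; have st : sorted (fun i j : 'I_n => i < j) ps.
  rewrite /enum_mem -enumT; apply: sorted_filter; first by move=> j i k; apply: ltn_trans.
  by have := iota_ltn_sorted 0 n; rewrite -val_enum_ord sorted_map.
have tr : transitive (fun i j : 'I_n => i < j) by move=> j i k; apply: ltn_trans.
have H i j : i \in I -> j \in I -> idx i < idx j -> i < j.
  by move=> iI jI; apply: (sorted_ltn_index tr st); rewrite mem_enum.
apply/idP/idP => [|ab]; first exact: H.
case: (ltngtP (idx a) (idx b)) => // [lt|e]; first by have := H b a bI aI lt; lia.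
have : nth a ps (idx a) = nth a ps (idx b) by rewrite e.
by rewrite !nth_index ?mem_enum // => e'; move: ab; rewrite e' ltnn.
Qed.

Lemma idx_inj a b : a \in I -> b \in I -> idx a = idx b -> a = b.
Proof.
move=> aI bI e; have : nth a ps (idx a) = nth a ps (idx b) by rewrite e.
by rewrite !nth_index ?mem_enum.
Qed.

Lemma idx_size a : a \in I -> idx a < #|I|.
Proof. by move=> aI; rewrite cardE index_mem mem_enum. Qed.

Lemma idx_ex t : t < #|I| -> exists2 a, a \in I & idx a = t.
Proof.
rewrite cardE => lt; have [a0 _] : exists a0, a0 \in ps.
  by case: ps lt => // a0 s _; exists a0; rewrite inE eqxx.
exists (nth a0 ps t); first by rewrite -mem_enum mem_nth.
by rewrite /idx index_uniq ?enum_uniq.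
Qed.

Section Rank.
Variable h : 'I_n -> nat.
Hypothesis h_inj : injective h.

Definition rank (v : nat) : nat := #|[set m in I | h m < v]|.

Lemma rank_lt c v : c \in I -> (rank (h c) < rank v) = (h c < v).
Proof.
move=> cI; apply/idP/idP => [|lt]; last first.
  apply: proper_card; apply/properP; split.
    by apply/subsetP => m; rewrite !inE => /andP[-> /=]; lia.
  by exists c; rewrite !inE cI ?lt ?ltnn.
apply: contraLR; rewrite -!leqNgt => le; apply: subset_leq_card.
by apply/subsetP => m; rewrite !inE => /andP[-> /=]; lia.
Qed.

Lemma rank_size c : c \in I -> rank (h c) < #|I|.
Proof.
move=> cI; apply: proper_card; apply/properP; split.
  by apply/subsetP => m; rewrite !inE => /andP[].
by exists c => //; rewrite !inE cI ltnn.
Qed.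

Definition ranks (e : 'I_n -> nat) : seq nat := [seq rank (e p) | p <- ps].

Lemma nth_ranks e a : a \in I -> nth 0 (ranks e) (idx a) = rank (e a).
Proof.
by move=> aI; rewrite (nth_map a) ?index_mem ?mem_enum // nth_index ?mem_enum.
Qed.

Lemma size_ranks e : size (ranks e) = #|I|.
Proof. by rewrite size_map -cardE. Qed.

Lemma ranks_perm : ranks h \in permutations (iota 0 #|I|).
Proof.
rewrite mem_permutations.
have u : uniq (ranks h).
  rewrite map_inj_in_uniq ?enum_uniq // => a b; rewrite !mem_enum => aI bI e.
  apply: h_inj; apply/eqP; rewrite eqn_leq (leqNgt (h a)) (leqNgt (h b)).
  by rewrite -(rank_lt (h b) aI) -(rank_lt (h a) bI) e ltnn.
have sub : {subset ranks h <= iota 0 #|I|}.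
  by move=> t /mapP[c]; rewrite mem_enum => cI ->; rewrite mem_iota /= rank_size.
apply: uniq_perm => //; first exact: iota_uniq.
by have [] := uniq_min_size u sub; rewrite ?size_iota ?size_ranks.
Qed.

End Rank.

Section Pattern.
Variables (x : 'S_n) (rk : 'I_n -> nat).
Hypothesis rk_inj : injective rk.

Local Notation pat z := (ranks (fun i => x i) (fun i => z i)).
Definition stable z := forall a, a \in I -> exists2 b, b \in I & z a = x b.

Lemma pat_lt z a b : stable z -> a \in I ->
  (rank (fun i => x i) (z a) < rank (fun i => x i) (z b)) = (z a < z b).
Proof. by move=> st aI; have [c cI ->] := st a aI; apply: rank_lt. Qed.

Lemma stable_swap z a b : a \in I -> b \in I -> stable z -> stable (tperm a b * z)%g.
Proof.
move=> aI bI st c cI; rewrite permM; by case: tpermP => *; apply: st.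
Qed.

Lemma pat_cover z a b : a \in I -> b \in I -> stable z -> cover_at z a b ->
  pattern_cover (pat z) (idx a, idx b).
Proof.
move=> aI bI st [ab zab ub]; rewrite /pattern_cover /= idx_lt // ab /= !nth_ranks //.
rewrite pat_lt // zab; apply/allP => t; rewrite mem_iota size_ranks /= add0n.
case/idx_ex=> m mI <-; rewrite !idx_lt // nth_ranks // !pat_lt //.
by apply/negP => /andP[/ub/negP]; apply.
Qed.

Lemma pat_swap z a b : a \in I -> b \in I ->
  pat (tperm a b * z)%g = pattern_swap (pat z) (idx a, idx b).
Proof.
move=> aI bI; apply: (@eq_from_nth _ 0); first by rewrite size_mkseq !size_ranks.
rewrite size_ranks => t /idx_ex[c cI <-]; rewrite nth_mkseq ?size_ranks ?idx_size //=.
rewrite nth_ranks // permM; case: tpermP => [->|->|/eqP ca /eqP cb].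
- by rewrite eqxx nth_ranks.
- case: eqP => [/(idx_inj bI aI) ->|_]; first by rewrite nth_ranks.
  by rewrite eqxx nth_ranks.
have -> : (idx c == idx a) = false by apply/eqP => /(idx_inj cI aI)/eqP; rewrite (negbTE ca).
have -> : (idx c == idx b) = false by apply/eqP => /(idx_inj cI bI)/eqP; rewrite (negbTE cb).
by rewrite nth_ranks.
Qed.

Definition inside ls := all (fun p => (p.1 \in I) && (p.2 \in I)) ls.

Lemma pat_chain z ls : chain z ls -> inside ls -> stable z ->
  stable (chain_end z ls) /\
  (map idx2 ls, pat (chain_end z ls)) \in pattern_chains (size ls) (pat z).
Proof.
elim: ls z => [|[a b] ls IH] z /=; first by move=> _ _ st; rewrite inE eqxx.
case=> cz ch /andP[/andP[aI bI] ins] st.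
have [st' mem] := IH _ ch ins (stable_swap aI bI st).
split=> //; apply/allpairsPdep; exists (idx a, idx b), (map idx2 ls, pat (chain_end (tperm a b * z)%g ls)).
split=> //=; last by rewrite -pat_swap.
rewrite mem_filter pat_cover //=; apply/allpairsP; exists (idx a, idx b).
by rewrite !mem_iota /= !size_ranks !add0n !idx_size.
Qed.

Definition label_lt (p q : 'I_n * 'I_n) := klex p.2 (rk p.1) (rk p.2) q.2 (rk q.1) (rk q.2).

Lemma pat_desc ls : inside ls -> sorted (fun p q => label_lt q p) ls ->
  pattern_desc (ranks rk rk) (map idx2 ls).
Proof.
move=> ins; rewrite /pattern_desc sorted_map.
apply: (@sub_in_sorted _ (fun p => (p.1 \in I) && (p.2 \in I)) (fun p q => label_lt q p)) ls ins.
move=> [a b] [c d] /andP[/= aI bI] /andP[/= cI dI].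
rewrite /pattern_lt /label_lt /relpre /= !nth_ranks // /klex !rank_lt // !idx_lt //.
have -> : (idx d == idx b) = (d == b :> nat).
  by apply/eqP/eqP => [/(idx_inj dI bI) ->//|/val_inj ->].
by [].
Qed.

End Pattern.
End Flatten.

Section DescUniq.
Variable n : nat.
Implicit Types (x y z : 'S_n) (a b c i j m : 'I_n) (ls : seq ('I_n * 'I_n)).
Variable rk : 'I_n -> nat.
Hypothesis rk_inj : injective rk.

Lemma desc_chain_uniq x ls ls' : chain x ls -> chain x ls' ->
  chain_end x ls = chain_end x ls' -> size ls = size ls' ->
  sorted (fun p q => label_lt rk q p) ls -> sorted (fun p q => label_lt rk q p) ls' ->
  let I := [set i | x i != chain_end x ls i] in
  inside I ls -> inside I ls' -> pattern_check #|I| (size ls) -> ohead ls = ohead ls'.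
Proof.
move=> ch ch' e es so so' I ins ins' chk.
have st : stable I x x by move=> a aI; exists a.
have [st1 m1] := pat_chain ch ins st; have [_ m2] := pat_chain ch' ins' st.
set u := ranks I (fun i => x i) (fun i => x i) in m1 m2 *.
have xi : injective (fun i => x i : nat) by move=> i j /val_inj/perm_inj.
have uP : u \in permutations (iota 0 #|I|) by apply: (ranks_perm I xi).
have cP : ranks I rk rk \in permutations (iota 0 #|I|) by apply: (ranks_perm I rk_inj).
have der t : t \in iota 0 #|I| ->
    nth 0 u t != nth 0 (ranks I (fun i => x i) (fun i => chain_end x ls i)) t.
  rewrite mem_iota /= add0n => /idx_ex[c cI <-]; rewrite !nth_ranks //.
  apply/eqP => e'; have [d dI ed] := st1 c cI.
  have := @rank_lt _ I (fun i => x i) c (chain_end x ls c) cI.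
  have := @rank_lt _ I (fun i => x i) d (x c) dI.
  rewrite -ed e' ltnn => l1 l2.
  by have := cI; rewrite inE -val_eqE neq_ltn /= -l1 -l2.
have /allP chk1 := allP chk u uP.
have F1 : (map (idx2 I) ls, ranks I (fun i => x i) (fun i => chain_end x ls i)) \in
    [seq c <- pattern_chains (size ls) u | all (fun t => nth 0 u t != nth 0 c.2 t) (iota 0 #|I|)].
  by rewrite mem_filter m1 andbT; apply/allP.
have F2 : (map (idx2 I) ls', ranks I (fun i => x i) (fun i => chain_end x ls i)) \in
    [seq c <- pattern_chains (size ls) u | all (fun t => nth 0 u t != nth 0 c.2 t) (iota 0 #|I|)].
  rewrite mem_filter; rewrite -e in m2; rewrite es m2 andbT; exact/allP.
have := allP (chk1 _ F1) _ F2; rewrite /= eqxx /=.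
case: eqP => [eo _|_ /allP/(_ _ cP)]; last by rewrite !pat_desc.
clearbody I; clear -es ins ins' eo; case: ls ls' es ins ins' eo => [|[a b] ls] [|[c d] ls'] //= _.
move=> /andP[/andP[/= aI bI] _] /andP[/andP[/= cI dI] _] [e1 e2].
by rewrite (idx_inj aI cI e1) (idx_inj bI dI e2).
Qed.

End DescUniq.

From mathcomp Require Import boolp classical_sets functions reals.
Import Order.TTheory GRing.Theory Num.Theory.

(** * Linear functionals on Bruhat intervals *)

Section Functionals.
Variables (R : realType) (n : nat).
Implicit Types (v w x y z a b : 'S_n) (i j k l m : 'I_n) (c : 'rV[R]_n).
Local Notation len := (@perm_length n).
Local Notation le := (@bruhat_le n).
Local Notation covers := (cov le len).
Local Notation pt := (@perm_point R n).
Local Open Scope ring_scope.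

Lemma dotDr c (u u' : 'rV[R]_n) : dot c (u + u') = dot c u + dot c u'.
Proof. by rewrite /dot -big_split; apply: eq_bigr => i _; rewrite mxE mulrDr. Qed.

Lemma dotZr c t (u : 'rV[R]_n) : dot c (t *: u) = t * dot c u.
Proof. by rewrite /dot mulr_sumr; apply: eq_bigr => i _; rewrite mxE mulrCA. Qed.

Lemma dotBr c (u u' : 'rV[R]_n) : dot c (u - u') = dot c u - dot c u'.
Proof. by rewrite dotDr -scaleN1r dotZr mulN1r. Qed.

Lemma dot_sumr c (I : Type) (r : seq I) (F : I -> 'rV[R]_n) :
  dot c (\sum_(i <- r) F i) = \sum_(i <- r) dot c (F i).
Proof.
apply: (big_morph (dot c)) => [u u'|]; first exact: dotDr.
by rewrite /dot big1 // => i _; rewrite mxE mulr0.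
Qed.

Lemma dotDl c c' (u : 'rV[R]_n) : dot (c + c') u = dot c u + dot c' u.
Proof. by rewrite /dot -big_split; apply: eq_bigr => i _; rewrite mxE mulrDl. Qed.

Lemma dotZl c t (u : 'rV[R]_n) : dot (t *: c) u = t * dot c u.
Proof. by rewrite /dot mulr_sumr; apply: eq_bigr => i _; rewrite mxE mulrA. Qed.

Lemma span_separate (u : 'rV[R]_n) (vs : seq 'rV[R]_n) : u \notin <<vs>>%VS ->
  exists2 c, {in vs, forall u, dot c u = 0} & dot c u = 1.
Proof.
move=> uV; pose A := \matrix_(i < size vs) tnth (in_tuple vs) i.
have : u *m cokermx A != 0.
  apply: contra uV; rewrite -submxE => /submxP[D ->]; rewrite mulmx_sum_row.
  apply: memv_suml => i _; apply: memvZ; apply: memv_span.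
  by rewrite rowK mem_tnth.
case/matrix0Pn=> i [j]; rewrite ord1 => e0.
pose e := (u *m cokermx A) 0 j.
have dotE (x : 'rV[R]_n) : dot (\row_k (cokermx A k j / e)) x = (x *m cokermx A) 0 j / e.
  rewrite /dot mxE mulr_suml; apply: eq_bigr => k _; rewrite mxE; ring.
exists (\row_k (cokermx A k j / e)); last by rewrite dotE divff.
move=> x /(nthP 0)[k lt <-].
have -> : vs`_k = row (Ordinal lt) A by rewrite rowK (tnth_nth 0).
by rewrite dotE -row_mul mulmx_coker !mxE mul0r.
Qed.

Definition ev c z : R := dot c (pt z).

Lemma ev_swap c z i j : i != j ->
  ev c (tperm i j * z)%g = ev c z + (c 0 i - c 0 j) * ((z j)%:R - (z i)%:R).
Proof.
move=> ij; rewrite /ev /dot (bigD1 i) //= (bigD1 j) 1?eq_sym //=.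
rewrite [in RHS](bigD1 i) //= [in RHS](bigD1 j) 1?eq_sym //= !mxE !permM tpermL tpermR.
set S := \sum_(_ < _ | _) _; set S' := \sum_(_ < _ | _) _.
have -> : S = S'.
  by apply: eq_bigr => m /andP[mi mj]; rewrite !mxE permM tpermD // eq_sym.
by rewrite -!natr1; ring.
Qed.

Lemma ev_swap_eq c z i j : i != j ->
  (ev c (tperm i j * z)%g == ev c z) = (c 0 i == c 0 j).
Proof.
move=> ij; rewrite ev_swap // -subr_eq0 addrC addKr mulf_eq0 !subr_eq0 orbC.
by rewrite eqr_nat (inj_eq val_inj) (inj_eq perm_inj) eq_sym (negbTE ij).
Qed.

Lemma ev_swap_lt c z i j : (z i < z j)%N ->
  (ev c z < ev c (tperm i j * z)%g) = (c 0 j < c 0 i).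
Proof.
move=> zij; have ij : i != j by apply: contraTneq zij => ->; rewrite ltnn.
by rewrite ev_swap // ltrDl pmulr_lgt0 ?subr_gt0 // ltr_nat.
Qed.

Definition const_on c x y := forall z, le x z -> le z y -> ev c z = ev c x.

Lemma const_on_sub c x y x' y' : const_on c x y -> le x x' -> le y' y -> const_on c x' y'.
Proof.
move=> co xx yy z xz zy; have zy' := bruhat_le_trans zy yy.
by rewrite (co z (bruhat_le_trans xx xz) zy') (co x' xx (bruhat_le_trans xz zy')).
Qed.

Lemma diamond_span c x (a a' b : 'S_n) : covers x a -> covers a b -> covers x a' -> covers a' b ->
  ev c a = ev c x -> ev c b = ev c a -> ev c a' = ev c x.
Proof.
case/coverP=> i [j [ij xij _ ->]] /coverP[k [l [kl xkl _ ->]]].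
case/coverP=> i' [j' [ij' xij' _ ->]] /coverP[k' [l' [kl' xkl' _ e]]] /eqP e1 /eqP e2.
move: e1 e2; rewrite !ev_swap_eq ?ord_neq_lt // => /eqP e1 /eqP e2.
apply/eqP; rewrite ev_swap_eq ?ord_neq_lt //; apply/eqP.
have inv m : c 0 (tperm i j (tperm k l m)) = c 0 m.
  have E p q : c 0 p = c 0 q -> forall m, c 0 (tperm p q m) = c 0 m.
    by move=> epq m'; case: tpermP => // ->.
  by rewrite !E.
have inv' m : c 0 (tperm i' j' (tperm k' l' m)) = c 0 m.
  rewrite -[in RHS]inv; have := congr1 (fun p : 'S_n => p m) e.
  by rewrite !permM => /perm_inj ->.
have fix_i : tperm k' l' i' = i' -> c 0 i' = c 0 j'.
  by move=> f; rewrite -[LHS]inv' f tpermL.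
have fix_j : tperm k' l' j' = j' -> c 0 i' = c 0 j'.
  by move=> f; rewrite -[RHS]inv' f tpermR.
move: fix_i fix_j; case: tpermP => [ik|il|_ _ /(_ erefl)//]; last first.
  by move=> _; case: tpermP => [jk|jl|_ _ /(_ erefl)//];
    move: ij' kl'; rewrite il ?jk ?jl; lia.
move=> _; case: tpermP => [jk|jl|_ _ /(_ erefl)//]; first by move: ij'; rewrite ik jk; lia.
by move: xkl'; rewrite -ik -jl !permM tpermL tpermR; lia.
Qed.

Lemma const_extend c x (a w : 'S_n) : covers x a -> le a w -> ev c a = ev c x ->
  const_on c a w -> const_on c x w.
Proof.
have [d] := ubnP (len w - len x); elim: d x a => // d IH x a ld xa aw ea ca.
have Q a' : covers x a' -> le a' w -> ev c a' = ev c x /\ const_on c a' w.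
  move=> xa' aw'; have /connectP[p] := atoms_connected xa aw xa' aw'.
  elim: p a xa aw ea ca => [|a1 p IHp] a0 xa0 aw0 ea0 ca0 /=; first by move=> _ ->.
  case/andP=> /and3P[_ xa1 /existsP[b /and3P[ab a1b bw]]].
  have eb : ev c b = ev c a0 by apply: ca0 => //; apply: cov_le ab.
  have e1 := diamond_span xa0 ab xa1 a1b ea0 eb.
  have aw1 := bruhat_le_trans (cov_le a1b) bw.
  apply: IHp => //; apply: (IH a1 b) => //.
  - by have := cov_len xa1; have := bruhat_le_len aw1; move: ld; lia.
  - by rewrite e1 eb.
  - by apply: const_on_sub ca0 (cov_le ab) (bruhat_le_refl w).
move=> z xz zw; have [->//|nxz] := eqVneq z x.
have [|a' xa' az] := atom_ex xz; first by rewrite eq_sym.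
have [e co] := Q a' xa' (bruhat_le_trans az zw).
by rewrite co.
Qed.

Lemma const_cat c v x w : le v x -> le x w -> const_on c v x -> const_on c x w ->
  const_on c v w.
Proof.
move=> + xw + cx; have [d] := ubnP (len x - len v); elim: d v => // d IH v ld vx cv.
have [->//|nvx] := eqVneq v x; have [a va ax] := atom_ex vx nvx.
apply: (const_extend va (bruhat_le_trans ax xw)); first by apply: cv => //; apply: cov_le va.
apply: IH => //; last by apply: const_on_sub cv (cov_le va) (bruhat_le_refl x).
by have := cov_len va; have := bruhat_le_len ax; move: ld; lia.
Qed.

Lemma chain_vectors x y : le x y -> exists vs : seq 'rV[R]_n, size vs = (len y - len x)%N /\
  forall c, {in vs, forall u, dot c u = 0} -> const_on c x y.
Proof.
have [d] := ubnP (len y - len x); elim: d x => // d IH x ld xy.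
have [<-|nxy] := eqVneq x y.
  exists [::]; rewrite subnn; split=> // c _ z xz zx.
  by rewrite (bruhat_le_anti xz zx).
have [a xa ay] := atom_ex xy nxy; have la := cov_len xa; have ly := bruhat_le_len ay.
have [|vs [sz co]] := IH a _ ay; first by move: ld; lia.
exists ((pt a - pt x) :: vs); split=> [|c ck]; first by rewrite /= sz; lia.
apply: (const_extend xa ay); last by apply: co => u us; apply: ck; rewrite inE us orbT.
by apply/eqP; rewrite -subr_eq0 -dotBr ck // inE eqxx.
Qed.

Lemma const_hull c v w u : const_on c v w -> bruhat_polytope R v w u -> dot c u = ev c v.
Proof.
move=> co [k [p [a [pP _ a1 ->]]]]; rewrite dot_sumr.
rewrite -[RHS]mul1r -a1 mulr_suml; apply: eq_bigr => i _; rewrite dotZr.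
by have [z /= + <-] := pP i; rewrite inE => /andP[vz zw]; rewrite -[dot _ _]/(ev c z) co.
Qed.

Lemma const_affine_hull c v w u : const_on c v w ->
  affine_hull (bruhat_polytope R v w) u -> dot c u = ev c v.
Proof.
move=> co [k [p [a [pP a1 ->]]]]; rewrite dot_sumr.
rewrite -[RHS]mul1r -a1 mulr_suml; apply: eq_bigr => i _.
by rewrite dotZr (const_hull co (pP i)).
Qed.

Lemma toric_separate v w x y : toric R v w -> le v x -> covers x y -> le y w ->
  exists c, [/\ const_on c v x, const_on c y w & ev c x < ev c y].
Proof.
move=> [x0 [U [hullE dimU]]] vx xy yw.
have [vs1 [s1 co1]] := chain_vectors vx; have [vs2 [s2 co2]] := chain_vectors yw.
have lx := bruhat_le_len vx; have lxy := cov_len xy; have lw := bruhat_le_len yw.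
have hullU u : affine_hull (bruhat_polytope R v w) u <-> u - x0 \in U.
  by rewrite hullE.
suff : pt y - pt x \notin <<vs1 ++ vs2>>%VS.
  move=> /span_separate[c ck c1]; exists c; split.
  - by apply: co1 => u us; apply: ck; rewrite mem_cat us.
  - by apply: co2 => u us; apply: ck; rewrite mem_cat us orbT.
  - by rewrite -subr_gt0 -dotBr c1.
apply/negP => inS.
have sub : (U <= <<vs1 ++ vs2>>)%VS.
  apply/subvP => u uU; apply: contraT => /span_separate[c ck c1].
  have cv : const_on c v w.
    apply: (@const_cat c v x w) => //; first exact: bruhat_le_trans (cov_le xy) yw.
      by apply: co1 => u' us; apply: ck; rewrite mem_cat us.
    apply: (const_extend xy yw); last first.
      by apply: co2 => u' us; apply: ck; rewrite mem_cat us orbT.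
    apply/eqP; rewrite -subr_eq0 -dotBr; apply/eqP.
    rewrite (@coord_span _ _ _ (in_tuple (vs1 ++ vs2)) _ inS) dot_sumr big1 // => i _.
    rewrite dotZr ck ?mulr0 //.
    by rewrite (_ : _`_i = tnth (in_tuple (vs1 ++ vs2)) i) ?mem_tnth // (tnth_nth 0).
  have h0 : affine_hull (bruhat_polytope R v w) x0 by apply/hullU; rewrite subrr mem0v.
  have h1 : affine_hull (bruhat_polytope R v w) (x0 + u) by apply/hullU; rewrite addrC addKr.
  have := const_affine_hull cv h1; rewrite dotDr (const_affine_hull cv h0) c1 => /eqP.
  by rewrite -subr_eq0 addrAC subrr add0r oner_eq0.
have := leq_trans (dimvS sub) (dim_span _).
by rewrite dimU size_cat s1 s2; move: lx lxy lw; clear; lia.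
Qed.

End Functionals.

Definition kval (N b ra rb : nat) : nat :=
  if rb < ra then N * N + (N - b) * N + ra else b * N + ra.

Lemma ltn_digits N q q' r r' : r < N -> r' < N ->
  (q * N + r < q' * N + r') = (if q == q' then r < r' else q < q').
Proof.
move=> rN rN'; case: (ltngtP q q') => [lt|lt|->]; last by rewrite ltn_add2l.
- apply/idP; apply: (@leq_trans (q.+1 * N)); first by rewrite mulSn; lia.
  by apply: leq_trans (leq_addr _ _); rewrite leq_mul2r lt orbT.
- apply/negbTE; rewrite -leqNgt; apply: (@leq_trans (q'.+1 * N)); first by rewrite mulSn; lia.
  by apply: leq_trans (leq_addr _ _); rewrite leq_mul2r lt orbT.
Qed.

Lemma kval_pos N b ra rb : b < N -> ra < N -> (N * N <= kval N b ra rb) = (rb < ra).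
Proof.
move=> bN rN; rewrite /kval; case: ifP => _; first by rewrite -addnA leq_addr.
apply/negbTE; rewrite -ltnNge; apply: (@leq_trans (b.+1 * N)).
  by rewrite mulSn; lia.
by rewrite leq_mul2r bN orbT.
Qed.

Lemma kval_lt N b ra rb b' ra' rb' : b < N -> ra < N -> b' < N -> ra' < N ->
  (kval N b ra rb < kval N b' ra' rb') = klex b ra rb b' ra' rb'.
Proof.
move=> bN rN bN' rN'; have p := kval_pos rb bN rN; have p' := kval_pos rb' bN' rN'.
rewrite /klex; case: ifP p => [lt|nlt] p; case: ifP p' => [lt'|nlt'] p'.
- rewrite /kval lt lt' -!addnA ltn_add2l ltn_digits //.
  have -> : (N - b == N - b') = (b == b') by lia.
  by case: ifP => // _; lia.
- by apply/negbTE; lia.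
- by apply/idP; lia.
- by rewrite /kval nlt nlt' ltn_digits.
Qed.

Section Labels.
Variable n : nat.
Implicit Types (v w x y z : 'S_n) (i j k l m : 'I_n).
Local Notation len := (@perm_length n).
Local Notation le := (@bruhat_le n).
Local Notation covers := (cov le len).

Variable rk : 'I_n -> nat.
Hypothesis rk_bound : forall i, rk i < n.
Hypothesis rk_inj : injective rk.

Definition key i j : nat := kval n j (rk i) (rk j).

Lemma key_lt i j k l : (key i j < key k l) = label_lt rk (i, j) (k, l).
Proof. by rewrite /key kval_lt. Qed.

Lemma key_inj i j k l : key i j = key k l -> (i, j) = (k, l).
Proof.
move=> e; have := key_lt i j k l; have := key_lt k l i j; rewrite e ltnn /label_lt /klex /=.
have eb : (rk j < rk i) = (rk l < rk k).
  rewrite -(kval_pos (rk j) (ltn_ord j) (rk_bound i)) -(kval_pos (rk l) (ltn_ord l) (rk_bound k)).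
  by rewrite -/(key i j) -/(key k l) e.
rewrite !eb (eq_sym (l : nat)) => {eb}; case: (rk l < rk k) => /=; case: eqP => [/val_inj -> n1 n2|ne n1 n2].
- by congr (_, _); apply: rk_inj; lia.
- lia.
- by congr (_, _); apply: rk_inj; lia.
- lia.
Qed.

Lemma key_between : between key.
Proof.
move=> p q r pq qr; rewrite !key_lt /label_lt /klex /= eqxx.
have neq i j : i < j -> rk i <> rk j by move=> ij /rk_inj e; move: ij; rewrite e ltnn.
have := neq _ _ pq; have := neq _ _ qr; have := neq _ _ (ltn_trans pq qr).
have -> : (r == q :> nat) = false by lia.
have -> : (q == r :> nat) = false by lia.
by case: (ltngtP (rk p) (rk q)) => //; case: (ltngtP (rk q) (rk r)) => //;
  case: (ltngtP (rk p) (rk r)) => //=; lia.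
Qed.

Definition lam x y : nat :=
  if [pick p : 'I_n * 'I_n | (p.1 < p.2) && (y == tperm p.1 p.2 * x)%g] is Some p
  then key p.1 p.2 else 0.

Lemma lam_swap x i j : i < j -> lam x (tperm i j * x)%g = key i j.
Proof.
move=> ij; rewrite /lam; case: pickP => [[k l] /andP[/= kl /eqP/mulIg e]|/(_ (i, j))].
  by have [-> ->] := tperm_lt_inj ij kl e.
by rewrite /= ij eqxx.
Qed.

Lemma lam_pos x i j : i < j -> (n * n <= lam x (tperm i j * x)%g) = (rk j < rk i).
Proof. by move=> ij; rewrite lam_swap // /key kval_pos. Qed.

Lemma lam_inj x (a a' : 'S_n) : covers x a -> covers x a' -> lam x a = lam x a' -> a = a'.
Proof.
case/coverP=> i [j [ij _ _ ->]] /coverP[k [l [kl _ _ ->]]].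
by rewrite !lam_swap // => /key_inj[-> ->].
Qed.

Lemma lam_neq x (a b : 'S_n) : covers x a -> covers a b -> lam x a != lam a b.
Proof.
case/coverP=> i [j [ij xij _ ->]] /coverP[k [l [kl xkl _ ->]]].
rewrite !lam_swap //; apply/eqP => /key_inj[ei ej].
by move: xkl; rewrite -ei -ej !permM tpermL tpermR; lia.
Qed.

Lemma lam_flip x (a b : 'S_n) : covers x a -> covers a b -> lam x a < lam a b ->
  exists a', [/\ covers x a', covers a' b & lam x a < lam x a'].
Proof.
case/coverP=> i [j [ij xij u1 ->]] /coverP[k [l [kl xkl u2 ->]]].
rewrite !lam_swap // => lt.
have c1 : cover_at x i j by [].
have [i' [j' [k' [l' [d1 d2 -> _ H]]]]] := flip_cover c1 (And3 kl xkl u2).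
exists (tperm i' j' * x)%g; split; try exact: cover_at_covers.
by have [ij' _ _] := d1; rewrite lam_swap //; apply: H; [exact: key_between|].
Qed.

Lemma two_moved i j k l m : i < j -> k < l -> (i, j) != (k, l) ->
  m \in [:: i; j; k; l] -> tperm i j (tperm k l m) != m.
Proof.
move=> ij kl ne mI; apply/eqP => e.
have {}e : tperm k l m = tperm i j m by rewrite -[in RHS]e tpermK.
case/negP: ne; rewrite xpair_eqE; move: mI e; rewrite !inE => /or4P[] /eqP ->.
- rewrite tpermL; case: tpermP => [-> ->|ei e|_ _ e]; rewrite ?eqxx //.
    by move: ij kl; rewrite ei e; lia.
  by move: ij; rewrite e ltnn.
- rewrite tpermR; case: tpermP => [ej e|-> ->|_ _ e]; rewrite ?eqxx //.
    by move: ij kl; rewrite ej e; lia.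
  by move: ij; rewrite e ltnn.
- rewrite tpermL; case: tpermP => [-> ->|ek e|_ _ e]; rewrite ?eqxx //.
    by move: ij kl; rewrite ek e; lia.
  by move: kl; rewrite e ltnn.
rewrite tpermR; case: tpermP => [el e|-> ->|_ _ e]; rewrite ?eqxx //.
  by move: ij kl; rewrite el e; lia.
by move: kl; rewrite e ltnn.
Qed.

Lemma lam_descent2_uniq x (a a' y : 'S_n) : covers x a -> covers a y -> covers x a' -> covers a' y ->
  lam a y < lam x a -> lam a' y < lam x a' -> a = a'.
Proof.
case/coverP=> i [j [ij xij u1 ->]] /coverP[k [l [kl xkl u2 ey]]].
case/coverP=> i' [j' [ij' xij' u1' ->]] /coverP[k' [l' [kl' xkl' u2' ey']]].
rewrite {1}ey ey' !lam_swap // !key_lt => lt lt'.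
have nij m (p q p' q' : 'I_n) (u : 'S_n) : p < q -> p' < q' -> u p < u q ->
    (tperm p q * u)%g p' < (tperm p q * u)%g q' -> m \in [:: p; q; p'; q'] ->
    u m != (tperm p' q' * (tperm p q * u))%g m.
  move=> pq pq' upq upq' mI; rewrite !permM (inj_eq perm_inj) eq_sym two_moved //.
  by apply/eqP => -[ep eq]; move: upq'; rewrite -ep -eq !permM tpermL tpermR ltnNge ltnW.
suff [-> ->] : (i, j) = (i', j') by [].
apply: Some_inj; apply: (@desc_chain_uniq _ _ rk_inj x [:: (i, j); (k, l)] [:: (i', j'); (k', l')]);
  rewrite //= ?andbT //.
- by rewrite -ey -ey'.
- by apply/andP; split; rewrite !inE ?nij // !inE eqxx ?orbT.
- rewrite -ey ey'; apply/andP; split; rewrite !inE !nij // !inE eqxx ?orbT //.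
apply: pattern_check2; apply: leq_trans (card_size [:: i; j; k; l]).
apply: subset_leq_card; apply/fintype.subsetP => m; rewrite inE; apply: contraR.
rewrite !inE !negb_or => /and4P[mi mj mk ml].
by rewrite !permM !tpermD // eq_sym.
Qed.

Section ThreeMoved.
Variables (T : eqType) (c : 'I_n -> T) (i1 j1 i2 j2 i3 j3 : 'I_n).
Hypotheses (ij1 : i1 < j1) (ij2 : i2 < j2) (ij3 : i3 < j3).
Hypothesis ne12 : (i1, j1) != (i2, j2).
Hypotheses (c1 : c i1 = c j1) (c2 : c i2 = c j2) (c3 : c i3 <> c j3).

Lemma three_moved m : m \in [:: i1; j1; i2; j2; i3; j3] ->
  tperm i1 j1 (tperm i2 j2 (tperm i3 j3 m)) != m.
Proof.
have cinv : forall p, c (tperm i1 j1 (tperm i2 j2 p)) = c p.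
  have E p q : c p = c q -> forall m, c (tperm p q m) = c m.
    by move=> epq m'; case: tpermP => // ->.
  by move=> p; rewrite !E.
move=> mI; have [m3|m3] := boolP (m \in [:: i3; j3]); last first.
  rewrite [tperm i3 j3 m]tpermD.
  - apply: two_moved => //; move: mI m3; rewrite !inE.
    by case: (m == i1); case: (m == j1); case: (m == i2); case: (m == j2); case: (m == i3); case: (m == j3).
  - by apply: contra m3 => /eqP ->; rewrite !inE eqxx.
  - by apply: contra m3 => /eqP ->; rewrite !inE eqxx orbT.
apply/eqP => e; have := cinv (tperm i3 j3 m); rewrite e.
by move: m3; rewrite !inE => /orP[] /eqP ->; rewrite ?tpermL ?tpermR => /esym; auto.
Qed.

End ThreeMoved.

Lemma disjoint_label i1 j1 i2 j2 i3 j3 (q q' : 'I_n) : uniq [:: i1; j1; i2; j2; i3; j3] ->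
  i1 < j1 -> i2 < j2 -> i3 < j3 -> q < q' -> q \in [:: i1; j1; i2; j2; i3; j3] ->
  tperm i1 j1 (tperm i2 j2 (tperm i3 j3 q)) = q' ->
  (q, q') \in [:: (i1, j1); (i2, j2); (i3, j3)].
Proof.
move=> us ij1 ij2 ij3 qq' mq.
have D (a b m : 'I_n) : m != a -> m != b -> tperm a b m = m.
  by move=> ma mb; rewrite tpermD // eq_sym.
move: us; rewrite /= !inE !negb_or -!andbA.
repeat (case/andP; intro); move=> _; move: mq; rewrite !inE !orbA -!orbA => mq e.
case/or4P: mq e => [/eqP e|/eqP e|/eqP e|/or3P[] /eqP e]; move: qq'; rewrite e.
- by rewrite (D i3) // (D i2) // tpermL => _ ->; rewrite eqxx.
- by rewrite (D i3) // (D i2) // tpermR => + e'; rewrite -e' => /(ltn_trans ij1); rewrite ltnn.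
- by rewrite (D i3) // tpermL tpermD // => _ ->; rewrite eqxx orbT.
- by rewrite (D i3) // tpermR tpermD // => + e'; rewrite -e' => /(ltn_trans ij2); rewrite ltnn.
- by rewrite tpermL tpermD // tpermD // => _ ->; rewrite eqxx !orbT.
by rewrite tpermR tpermD // tpermD // => + e'; rewrite -e' => /(ltn_trans ij3); rewrite ltnn.
Qed.

(* The third label is independent of the first two, so no cancellation makes the product
   of the three transpositions fix a point that one of them moves. *)
Lemma lam_descent3_uniq (T : eqType) x (a b a' b' y : 'S_n) :
  (forall u u' u'' : 'S_n, covers x u -> covers u u' -> covers u' u'' -> u'' = y ->
     exists c : 'I_n -> T, forall i j i' j' i'' j'' : 'I_n, i < j -> i' < j' -> i'' < j'' ->
       u = (tperm i j * x)%g -> u' = (tperm i' j' * u)%g -> u'' = (tperm i'' j'' * u')%g ->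
       [/\ c i = c j, c i' = c j' & c i'' <> c j'']) ->
  covers x a -> covers a b -> covers b y -> covers x a' -> covers a' b' -> covers b' y ->
  lam b y < lam a b < lam x a -> lam b' y < lam a' b' < lam x a' -> a = a'.
Proof.
move=> sep xa ab by_ xa' ab' by_'.
have [c cP] := sep _ _ _ xa ab by_ erefl; have [c' cP'] := sep _ _ _ xa' ab' by_' erefl.
case/coverP: xa ab by_ cP => i1 [j1 [ij1 v1 u1 ->]].
case/coverP=> i2 [j2 [ij2 v2 u2 ->]] /coverP[i3 [j3 [ij3 v3 u3 ey]]].
case/(_ _ _ _ _ _ _ ij1 ij2 ij3 erefl erefl ey) => c1 c2 c3.
case/coverP: xa' ab' by_' cP' => k1 [l1 [kl1 w1 t1 ->]].
case/coverP=> k2 [l2 [kl2 w2 t2 ->]] /coverP[k3 [l3 [kl3 w3 t3 ey']]].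
case/(_ _ _ _ _ _ _ kl1 kl2 kl3 erefl erefl ey') => d1 d2 d3.
rewrite {1}ey {1}ey' !lam_swap // => /andP[lt32 lt21] /andP[lt32' lt21'].
have ne (p q p' q' : 'I_n) (u : 'S_n) : p < q -> (tperm p q * u)%g p' < (tperm p q * u)%g q' -> u p < u q ->
    (p, q) != (p', q').
  move=> pq + xpq; apply: contraTneq => -[<- <-].
  by rewrite !permM tpermL tpermR ltnNge ltnW.
have mv m : m \in [:: i1; j1; i2; j2; i3; j3] -> x m != y m.
  move=> mI; rewrite ey !permM (inj_eq perm_inj) eq_sym.
  by apply: (@three_moved _ c) => //; apply: (ne _ _ _ _ x).
have mv' m : m \in [:: k1; l1; k2; l2; k3; l3] -> x m != y m.
  move=> mI; rewrite ey' !permM (inj_eq perm_inj) eq_sym.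
  by apply: (@three_moved _ c') => //; apply: (ne _ _ _ _ x).
suff [-> ->] : (i1, j1) = (k1, l1) by [].
pose I := [set m | x m != y m]%SET.
have sub p1 q1 p2 q2 p3 q3 : y = (tperm p3 q3 * (tperm p2 q2 * (tperm p1 q1 * x)))%g ->
    {subset I <= [:: p1; q1; p2; q2; p3; q3]}.
  move=> e m; rewrite inE; apply: contraR; rewrite !inE !negb_or.
  repeat (case/andP; intro); intro; rewrite e !permM; apply/eqP.
  by rewrite !(tpermD (z := m)) // eq_sym.
have [le5|gt5] := leqP #|I| 5.
  apply: Some_inj; apply: (@desc_chain_uniq _ _ rk_inj x [:: (i1, j1); (i2, j2); (i3, j3)]
    [:: (k1, l1); (k2, l2); (k3, l3)]); rewrite //= -?key_lt ?andbT ?lt21 ?lt21' //.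
  - by rewrite -ey -ey'.
  - by rewrite -ey /inside /= !inE !mv // !inE eqxx ?orbT.
  - by rewrite -ey /inside /= !inE !mv' // !inE eqxx ?orbT.
  - by apply: pattern_check3; rewrite -ey.
have us p1 q1 p2 q2 p3 q3 : {subset I <= [:: p1; q1; p2; q2; p3; q3]} ->
    uniq [:: p1; q1; p2; q2; p3; q3].
  move=> /fintype.subsetP/subset_leq_card le.
  by apply/card_uniqP; apply/eqP; rewrite eqn_leq card_size (leq_trans gt5).
have S := sub _ _ _ _ _ _ ey; have S' := sub _ _ _ _ _ _ ey'.
have U := us _ _ _ _ _ _ S; have U' := us _ _ _ _ _ _ S'.
have fst (p1 q1 p2 q2 p3 q3 : 'I_n) : uniq [:: p1; q1; p2; q2; p3; q3] ->
    tperm p1 q1 (tperm p2 q2 (tperm p3 q3 p1)) = q1.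
  rewrite /= !inE !negb_or -!andbA; repeat (case/andP; intro); move=> _.
  by rewrite (tpermD (z := p1)) 1?eq_sym // (tpermD (z := p1)) 1?eq_sym // tpermL.
have same : (fun m => tperm i1 j1 (tperm i2 j2 (tperm i3 j3 m))) =1
            (fun m => tperm k1 l1 (tperm k2 l2 (tperm k3 l3 m))).
  move=> m; have := congr1 (fun p : 'S_n => p m) ey; rewrite {1}ey' !permM.
  by move/perm_inj.
have m1 : (i1, j1) \in [:: (k1, l1); (k2, l2); (k3, l3)].
  apply: (disjoint_label U') => //; last by rewrite -same fst.
  by apply: S'; rewrite inE mv // inE eqxx.
have m2 : (k1, l1) \in [:: (i1, j1); (i2, j2); (i3, j3)].
  apply: (disjoint_label U) => //; last by rewrite same fst.
  by apply: S; rewrite inE mv' // inE eqxx.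
apply: key_inj; apply/eqP; rewrite eqn_leq.
move: m1 m2; rewrite !inE => m1 m2; apply/andP; split.
  by case/or3P: m1 => /eqP[-> ->]; lia.
by case/or3P: m2 => /eqP[-> ->]; lia.
Qed.

End Labels.

(** * Exposed subsets of toric intervals *)

Section Exposed.
Variables (R : realType) (n : nat).
Implicit Types (v w x y z p q : 'S_n) (i j k l m : 'I_n) (c : 'rV[R]_n).
Local Notation len := (@perm_length n).
Local Notation le := (@bruhat_le n).
Local Notation covers := (cov le len).
Local Notation itv := (@bruhat_interval n).
Local Open Scope ring_scope.

Section Priority.
Variables (c : 'rV[R]_n) (d : bool).

(* Priority of positions: by decreasing [c], ties broken towards small positions
   ([d = false]) or large ones ([d = true]). *)
Definition above i j : bool :=
  (c 0 j < c 0 i) || ((c 0 i == c 0 j) && (if d then (j < i)%N else (i < j)%N)).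

Definition prio i : nat := #|[set j | above i j]|.

Lemma above_irr i : above i i = false.
Proof. by rewrite /above ltxx eqxx /=; case: d; rewrite ltnn. Qed.

Lemma above_trans i j k : above i j -> above j k -> above i k.
Proof.
rewrite /above => /orP[lt|/andP[/eqP e l1]] /orP[lt'|/andP[/eqP e' l2]].
- by rewrite (lt_trans lt' lt).
- by rewrite -e' lt.
- by rewrite e lt'.
- by rewrite e e' eqxx /=; case: d l1 l2 => [l1 l2|l1 l2]; apply/orP; right; [exact: ltn_trans l1|exact: ltn_trans l2].
Qed.

Lemma above_total i j : i != j -> above i j || above j i.
Proof.
move=> ij; rewrite /above; case: (ltgtP (c 0 i) (c 0 j)) => //= _.
by case: d; have := ord_neq ij; lia.
Qed.

Lemma prio_lt i j : (prio j < prio i)%N = above i j.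
Proof.
have mono a b : above a b -> (prio b < prio a)%N.
  move=> ab; apply: proper_card; apply/properP; split.
    by apply/fintype.subsetP => m; rewrite !inE; apply: above_trans.
  by exists b; rewrite !inE ?above_irr.
apply/idP/idP => [|/mono //]; have [->|ij] := eqVneq i j; first by rewrite ltnn.
by case/orP: (above_total ij) => // /mono; lia.
Qed.

Lemma prio_bound i : (prio i < n)%N.
Proof.
rewrite -[X in (_ < X)%N]card_ord; apply: proper_card; apply/properP; split.
  exact/fintype.subsetP.
by exists i; rewrite ?inE ?above_irr.
Qed.

Lemma prio_inj : injective prio.
Proof.
move=> i j e; apply/eqP; apply: contraT => /above_total.
by rewrite -!prio_lt e ltnn.
Qed.

Local Notation lab := (lam prio).

Lemma lam_prio x y : covers x y ->
  (n * n <= lab x y)%N = (ev c x < ev c y) || ((ev c y == ev c x) && ~~ d).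
Proof.
case/coverP=> i [j [ij xij _ ->]]; have nij := ord_neq_lt ij.
rewrite (lam_pos prio_bound) // prio_lt /above ev_swap_lt // ev_swap_eq //.
by congr (_ || (_ && _)); case: d; lia.
Qed.

Lemma toric_local_max_uniq v w p q z z' : toric R v w -> le v p -> le q w ->
  local_max le len lab (n * n) p q z -> local_max le len lab (n * n) p q z' -> z = z'.
Proof.
move=> tor; apply: local_max_uniq.
- exact: bruhat_le_refl.
- exact: bruhat_le_trans.
- exact: bruhat_le_len.
- exact: bruhat_le_len_eq.
- exact: atom_ex.
- exact: atoms_connected.
- exact: (lam_inj prio_bound prio_inj).
- exact: (lam_neq prio_bound prio_inj).
- exact: (lam_flip prio_bound prio_inj).
- exact: (lam_descent2_uniq prio_bound prio_inj).
move=> x a b a' b' y vx yw; apply: (@lam_descent3_uniq _ _ prio_bound prio_inj R) => u u' u'' xu uu' uu'' ey.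
have vu := bruhat_le_trans vx (bruhat_le_trans (cov_le xu) (cov_le uu')).
rewrite -ey in yw; have [c' [co1 _ lt]] := toric_separate tor vu uu'' yw.
exists (c' 0) => i j i' j' i'' j'' ij ij' ij'' eu eu' eu''.
have ex : ev c' x = ev c' v.
  by apply: co1 => //; apply: bruhat_le_trans (cov_le xu) (cov_le uu').
have eu1 : ev c' u = ev c' v.
  by apply: co1; [apply: bruhat_le_trans vx (cov_le xu) | apply: cov_le uu'].
have eu2 : ev c' u' = ev c' v by apply: co1 => //; apply: bruhat_le_refl.
split; apply/eqP; rewrite -?(@ev_swap_eq R n c' _ _ _ (ord_neq_lt ij)).
- by rewrite -(ev_swap_eq _ x) ?ord_neq_lt // -eu ex eu1.
- by rewrite -(ev_swap_eq _ u) ?ord_neq_lt // -eu' eu1 eu2.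
by rewrite -(ev_swap_eq _ u') ?ord_neq_lt // -eu''; move/lt_eqF: lt; rewrite eq_sym => ->.
Qed.

End Priority.

Definition maximal_value c p q z :=
  [/\ le p z, le z q & forall y, le p y -> le y q -> ev c y <= ev c z].

Lemma local_max_top_max c p q z : maximal_value c p q z ->
  (forall y, covers z y -> le y q -> ev c y != ev c z) ->
  local_max le len (lam (prio c false)) (n * n) p q z.
Proof.
move=> [pz zq mz] ne; split=> // [y zy yq|u uz pu].
  rewrite ltnNge lam_prio // andbT negb_or -leNgt (ne y) // andbT.
  by apply: mz => //; apply: bruhat_le_trans pz (cov_le zy).
rewrite lam_prio // andbT; have := mz u pu (bruhat_le_trans (cov_le uz) zq).
by rewrite le_eqVlt => /orP[/eqP ->|->]; rewrite ?eqxx ?orbT.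
Qed.

Lemma local_max_bot_max c p q z : maximal_value c p q z ->
  (forall u, covers u z -> le p u -> ev c u != ev c z) ->
  local_max le len (lam (prio c true)) (n * n) p q z.
Proof.
move=> [pz zq mz] ne; split=> // [y zy yq|u uz pu].
  rewrite ltnNge lam_prio // andbF orbF -leNgt.
  by apply: mz => //; apply: bruhat_le_trans pz (cov_le zy).
rewrite lam_prio // andbF orbF lt_neqAle ne //=.
by apply: mz => //; apply: bruhat_le_trans (cov_le uz) zq.
Qed.

Lemma climb_max c p q z : maximal_value c p q z ->
  exists z', [/\ le z z', maximal_value c p q z'
                & forall y, covers z' y -> le y q -> ev c y != ev c z'].
Proof.
move=> mz; have [pz zq zm] := mz.
pose P y := [&& le z y, le y q & ev c y == ev c z].
have Pz : P z by rewrite /P bruhat_le_refl zq eqxx.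
case: (arg_maxnP len Pz) => z' /and3P[zz' zq' /eqP e] zm'.
exists z'; split=> //.
  by split=> // [|y]; [apply: bruhat_le_trans pz zz' | rewrite e; apply: zm].
move=> y zy yq; apply/eqP => ey.
have := zm' y; rewrite /P yq ey e eqxx (bruhat_le_trans zz' (cov_le zy)) (cov_len zy).
by move/(_ isT); rewrite /= ltnn.
Qed.

Lemma descend_max c p q z : maximal_value c p q z ->
  exists z', [/\ le z' z, maximal_value c p q z'
                & forall u, covers u z' -> le p u -> ev c u != ev c z'].
Proof.
move=> mz; have [pz zq zm] := mz.
pose P y := [&& le y z, le p y & ev c y == ev c z].
have Pz : P z by rewrite /P bruhat_le_refl pz eqxx.
case: (arg_minnP len Pz) => z' /and3P[zz' zq' /eqP e] zm'.
exists z'; split=> //.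
  by split=> // [|y]; [apply: bruhat_le_trans zz' zq | rewrite e; apply: zm].
move=> u uz pu; apply/eqP => eu.
have := zm' u; rewrite /P pu eu e eqxx (bruhat_le_trans (cov_le uz) zz') (cov_len uz).
by move/(_ isT); rewrite ltnn.
Qed.

Section Toric.
Variables v w : 'S_n.
Hypothesis tor : toric R v w.

Lemma max_le_top c p q z z' : le v p -> le q w -> maximal_value c p q z ->
  maximal_value c p q z' -> (forall y, covers z' y -> le y q -> ev c y != ev c z') -> le z z'.
Proof.
move=> vp qw mz mz' nz'; have [z1 [zz1 mz1 nz1]] := climb_max mz.
by rewrite (toric_local_max_uniq tor vp qw (local_max_top_max mz' nz') (local_max_top_max mz1 nz1)).
Qed.

Lemma bot_le_max c p q z z' : le v p -> le q w -> maximal_value c p q z ->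
  maximal_value c p q z' -> (forall u, covers u z' -> le p u -> ev c u != ev c z') -> le z' z.
Proof.
move=> vp qw mz mz' nz'; have [z1 [zz1 mz1 nz1]] := descend_max mz.
by rewrite (toric_local_max_uniq tor vp qw (local_max_bot_max mz' nz') (local_max_bot_max mz1 nz1)).
Qed.

Lemma ev_noninc c q x : le x q ->
  (forall y, covers x y -> le y q -> (lam (prio c false) x y < n * n)%N) -> ev c q <= ev c x.
Proof.
have [k] := ubnP (len q - len x)%N; elim: k x => // k IH x lek xq neg.
have [->//|nxq] := eqVneq x q.
have tP := topP (@atom_ex n) (lam (prio c false)).
have tg := top_good (@bruhat_le_trans n) (@atom_ex n)
  (lam_neq (prio_bound c false) (@prio_inj c false)) (lam_flip (prio_bound c false) (@prio_inj c false)).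
have [xa aq _] := tP _ _ xq nxq; have ga := tg _ _ xq nxq.
have la := neg _ xa aq.
apply: (@le_trans _ _ (ev c (top le len (lam (prio c false)) q x))).
  apply: IH => //; first by have := cov_len xa; have := bruhat_le_len aq; move: lek; lia.
  by move=> y ay yq; apply: ltn_trans (ga _ ay yq) la.
by move: la; rewrite ltnNge lam_prio // andbT negb_or -leNgt => /andP[].
Qed.

Lemma const_between c x q : le x q -> ev c x = ev c q ->
  (forall y, le x y -> le y q -> ev c y <= ev c q) -> const_on c x q.
Proof.
have [k] := ubnP (len q - len x)%N; elim: k x => // k IH x lek xq exq mx.
have [->|nxq] := eqVneq x q.
  by move=> z qz zq; rewrite (bruhat_le_anti qz zq).
have [xa aq _] := topP (@atom_ex n) (lam (prio c false)) xq nxq.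
have ga := top_good (@bruhat_le_trans n) (@atom_ex n)
  (lam_neq (prio_bound c false) (@prio_inj c false))
  (lam_flip (prio_bound c false) (@prio_inj c false)) xq nxq.
set a := top _ _ _ _ _ in xa aq ga.
suff ea : ev c a = ev c q.
  apply: (const_extend xa aq); first by rewrite ea exq.
  apply: IH => //; first by have := cov_len xa; have := bruhat_le_len aq; move: lek; lia.
  by move=> y ay; apply: mx; apply: bruhat_le_trans (cov_le xa) ay.
apply: le_anti; rewrite mx ?(cov_le xa) //=.
have [pos|neg] := leqP (n * n) (lam (prio c false) x a).
  rewrite -exq; move: pos; rewrite lam_prio // andbT => /orP[/ltW//|/eqP -> //].
by apply: ev_noninc => // y ay yq; apply: ltn_trans (ga _ ay yq) neg.
Qed.

Definition exposed p q (S : {set 'S_n}) : Prop := exists c b,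
  (forall z, z \in itv p q -> ev c z <= b) /\ S = [set z in itv p q | ev c z == b]%SET.

Lemma mem_bruhat_interval p q z : (z \in itv p q) = le p z && le z q.
Proof. by rewrite inE. Qed.

Lemma exposed_is_interval S : exposed v w S -> S = finset.set0 \/
  exists p q, [/\ le v p, le p q, le q w & S = itv p q].
Proof.
case=> c [b [cb SE]]; have [->|/set0Pn[z0 z0S]] := eqVneq S finset.set0; [by left|right].
have Sm z : z \in S <-> maximal_value c v w z.
  have z0b : ev c z0 = b by move: z0S; rewrite SE inE => /andP[_ /eqP].
  have z0i : z0 \in itv v w by move: z0S; rewrite SE inE => /andP[].
  rewrite SE inE mem_bruhat_interval; split=> [/andP[/andP[vz zw] /eqP e]|[vz zw mz]].
    by split=> // y vy yw; rewrite e; apply: cb; rewrite mem_bruhat_interval vy.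
  rewrite vz zw /=; apply/eqP/le_anti; rewrite cb ?mem_bruhat_interval ?vz //= -z0b.
  by move: z0i; rewrite mem_bruhat_interval => /andP[*]; apply: mz.
have [q [zq mq nq]] := climb_max ((Sm z0).1 z0S).
have [p [pz mp np]] := descend_max ((Sm z0).1 z0S).
have [vp pw maxp] := mp; have [vq qw maxq] := mq.
have pq := bruhat_le_trans pz zq.
exists p, q; split=> //; apply/setP => z; rewrite mem_bruhat_interval; apply/idP/andP => [/Sm mz|[pz' zq']].
  split; first exact: (bot_le_max (bruhat_le_refl v) (bruhat_le_refl w) mz mp np).
  exact: (max_le_top (bruhat_le_refl v) (bruhat_le_refl w) mz mq nq).
have epq : ev c p = ev c q by apply: le_anti; rewrite maxq ?maxp.
have co : const_on c p q.
  apply: const_between => // y py yq; apply: maxq; first exact: bruhat_le_trans vp py.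
  exact: bruhat_le_trans yq qw.
apply/Sm; split; [exact: bruhat_le_trans vp pz' | exact: bruhat_le_trans zq' qw |].
by rewrite (co z).
Qed.

Lemma exposed_refl p q : exposed p q (itv p q).
Proof.
have ev0 z : ev (0 : 'rV[R]_n) z = 0 by rewrite /ev /dot big1 // => i _; rewrite mxE mul0r.
exists 0, 0; split=> [z _|]; first by rewrite ev0.
by apply/setP => z; rewrite [RHS]inE ev0 eqxx andbT.
Qed.

Lemma exposed_set0 p q : exposed p q finset.set0.
Proof.
have ev0 z : ev (0 : 'rV[R]_n) z = 0 by rewrite /ev /dot big1 // => i _; rewrite mxE mul0r.
exists 0, 1; split=> [z _|]; first by rewrite ev0.
by apply/setP => z; rewrite !inE ev0 eq_sym oner_eq0 andbF.
Qed.

Lemma exposed_trans p q p' q' S : exposed p q (itv p' q') -> exposed p' q' S -> exposed p q S.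
Proof.
case=> c [b [cb E]] [c' [b' [cb' ->]]].
have sub z : z \in itv p' q' -> z \in itv p q /\ ev c z = b.
  by rewrite E inE => /andP[-> /eqP].
pose K := 1 + \sum_(z in itv p q :\: itv p' q') `|(ev c' z - b') / (b - ev c z)|.
have evE z : ev (c' + K *: c) z = ev c' z + K * ev c z by rewrite /ev dotDl dotZl.
have out z : z \in itv p q -> z \notin itv p' q' -> ev (c' + K *: c) z < b' + K * b.
  move=> zi zo; have lt : ev c z < b.
    by rewrite lt_neqAle cb // andbT; move: zo; rewrite E inE zi.
  rewrite evE; suff h : ev c' z - b' < K * (b - ev c z) by move: h; rewrite mulrBr; lra.
  have pos : 0 < b - ev c z by rewrite subr_gt0.
  have zD : z \in itv p q :\: itv p' q' by rewrite finset.in_setD zo zi.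
  rewrite -ltr_pdivrMr // /K (bigD1 z) //=.
  set x := _ / _; set s := \sum_(_ in _ | _) _.
  have s0 : 0 <= s by apply: sumr_ge0.
  have := ler_norm x; lra.
exists (c' + K *: c), (b' + K * b); split=> [z zi|].
  have [zi'|zo] := boolP (z \in itv p' q'); last exact/ltW/out.
  by have [_ e] := sub z zi'; rewrite evE e lerD2r cb'.
apply/setP => z; rewrite ![in LHS]inE -mem_bruhat_interval [in RHS]inE.
have [zi'|zo] := boolP (z \in itv p' q').
  by have [-> e] := sub z zi'; rewrite evE e /= (inj_eq (addIr _)).
by apply/esym/negbTE/negP => /andP[zi /eqP e]; have := out z zi zo; rewrite e ltxx.
Qed.

Lemma max_ex c p q : le p q -> exists z, maximal_value c p q z.
Proof.
move=> pq; pose P z := le p z && le z q.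
have pP : P p by rewrite /P bruhat_le_refl.
case: (arg_maxP (fun z => ev c z) pP) => z /andP[pz zq] mz.
by exists z; split=> // y py yq; apply: mz; rewrite /P py.
Qed.

Lemma exposed_coatom p y q : le v p -> le p y -> covers y q -> le q w ->
  exposed p q (itv p y).
Proof.
move=> vp py yq qw; have vy := bruhat_le_trans vp py; have yq' := cov_le yq.
have [c0 [co _ lt0]] := toric_separate tor vy yq qw.
pose c := -1 *: c0.
have evN z : ev c z = - ev c0 z by rewrite /ev dotZl mulN1r.
have cst z : le p z -> le z y -> ev c z = ev c y.
  move=> pz zy; rewrite !evN (co z) ?(co y) ?bruhat_le_refl //.
  exact: bruhat_le_trans vp pz.
have [z mz] := max_ex c (bruhat_le_trans py yq'); have [z0 [_ mz0 nz0]] := climb_max mz.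
have lmy : local_max le len (lam (prio c false)) (n * n) p q y.
  split=> // [u yu uq|u uy pu].
    have -> : u = q by apply: bruhat_le_len_eq; rewrite // (cov_len yu) (cov_len yq).
    by rewrite ltnNge lam_prio // andbT negb_or -leNgt !evN lerN2 ltW //= eqr_opp gt_eqF.
  by rewrite lam_prio // cst ?eqxx ?orbT //; apply: cov_le uy.
have ey := toric_local_max_uniq tor vp qw lmy (local_max_top_max mz0 nz0).
rewrite -ey in mz0 nz0; have [_ _ my] := mz0.
exists c, (ev c y); split=> [u|]; first by rewrite mem_bruhat_interval => /andP[pu uq]; apply: my.
apply/setP => u; rewrite [in RHS]inE !mem_bruhat_interval; apply/andP/andP => [[pu uy]|[/andP[pu uq] /eqP e]].
  by rewrite pu (bruhat_le_trans uy yq') cst.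
split=> //; apply: (max_le_top vp qw _ mz0 nz0); split=> // u' pu' uq'.
by rewrite e; apply: my.
Qed.

Lemma exposed_atom p x q : le v p -> covers p x -> le x q -> le q w ->
  exposed p q (itv x q).
Proof.
move=> vp px xq qw; have px' := cov_le px.
have [c [_ co lt0]] := toric_separate tor vp px (bruhat_le_trans xq qw).
have cst z : le x z -> le z q -> ev c z = ev c x.
  by move=> xz zq; apply: co => //; apply: bruhat_le_trans zq qw.
have [z mz] := max_ex c (bruhat_le_trans px' xq); have [z0 [_ mz0 nz0]] := descend_max mz.
have lmx : local_max le len (lam (prio c true)) (n * n) p q x.
  split=> // [u xu uq|u ux pu].
    by rewrite ltnNge lam_prio // andbF orbF -leNgt cst //; apply: cov_le xu.
  have <- : p = u.
    apply: bruhat_le_len_eq => //; rewrite -ltnS -(cov_len ux) (cov_len px); exact: leqnn.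
  by rewrite lam_prio // lt0.
have ex := toric_local_max_uniq tor vp qw lmx (local_max_bot_max mz0 nz0).
rewrite -ex in mz0 nz0; have [_ _ mx] := mz0.
exists c, (ev c x); split=> [u|]; first by rewrite mem_bruhat_interval => /andP[pu uq]; apply: mx.
apply/setP => u; rewrite [in RHS]inE !mem_bruhat_interval; apply/andP/andP => [[xu uq]|[/andP[pu uq] /eqP e]].
  by rewrite uq (bruhat_le_trans px' xu) cst.
split=> //; apply: (bot_le_max vp qw _ mz0 nz0); split=> // u' pu' uq'.
by rewrite e; apply: mx.
Qed.

Lemma interval_exposed p q : le v p -> le p q -> le q w -> exposed v w (itv p q).
Proof.
move=> vp pq qw; apply: (@exposed_trans v w v q).
  have vq := bruhat_le_trans vp pq; clear p vp pq.
  have [k] := ubnP (len w - len q)%N; elim: k q qw vq => // k IH q qw vq lek.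
  have [->|nqw] := eqVneq q w; first exact: exposed_refl.
  have [q1 qq1 q1w] := atom_ex qw nqw.
  apply: (@exposed_trans _ _ v q1); last exact: exposed_coatom (bruhat_le_refl v) vq qq1 q1w.
  apply: IH => //; first exact: bruhat_le_trans vq (cov_le qq1).
  by have := cov_len qq1; have := bruhat_le_len q1w; move: lek; lia.
have := bruhat_le_refl v; move: {1 3 4}v vp => x xp vx.
have [k] := ubnP (len p - len x)%N; elim: k x xp vx => // k IH x xp vx lek.
have [->|nxp] := eqVneq x p; first exact: exposed_refl.
have [x1 xx1 x1p] := atom_ex xp nxp.
apply: (@exposed_trans _ _ x1 q).
  exact: exposed_atom vx xx1 (bruhat_le_trans x1p pq) qw.
apply: IH => //; first exact: bruhat_le_trans vx (cov_le xx1).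
by have := cov_len xx1; have := bruhat_le_len x1p; move: lek; lia.
Qed.

End Toric.
End Exposed.

Section Faces.
Variables (R : realType) (n : nat) (v w : 'S_n).
Implicit Types (z : 'S_n) (c : 'rV[R]_n) (S : {set 'S_n}) (F G : set 'rV[R]_n).
Local Notation pt := (@perm_point R n).
Local Notation M := (bruhat_interval v w).
Local Notation P := (bruhat_polytope R v w).
Local Open Scope ring_scope.
Local Open Scope classical_set_scope.

Definition hull S : set 'rV[R]_n := convex_hull [set pt z | z in [set` S]].

Definition vertices F : {set 'S_n} := [set z in M | `[< F (pt z) >]]%SET.

Lemma hull_mono S S' : S \subset S' -> hull S `<=` hull S'.
Proof.
move=> /fintype.subsetP sub x [k [p [a [pS a0 a1 ->]]]]; exists k, p, a; split=> // i.
by have [z /= /sub zS <-] := pS i; exists z.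
Qed.

Lemma pt_hull S z : z \in S -> hull S (pt z).
Proof.
move=> zS; exists 1%N, (fun=> pt z), (fun=> 1); rewrite !big_ord1 scale1r; split=> // _.
by exists z.
Qed.

Lemma face_hull c b : (forall z, z \in M -> ev c z <= b) ->
  [set x | P x /\ dot c x = b] = hull [set z in M | ev c z == b]%SET.
Proof.
move=> cb; apply/seteqP; split=> [x [[k [p [a [pM a0 a1 ->]]]]]|x].
  rewrite dot_sumr => e.
  have pb i : dot c (p i) <= b by have [z /= zM <-] := pM i; apply: cb.
  have z0 i : a i != 0 -> dot c (p i) = b.
    move=> ai; have : \sum_i a i * (b - dot c (p i)) == 0.
      under eq_bigr do rewrite mulrBr.
      rewrite sumrB -mulr_suml a1 mul1r -[X in X - _]e subr_eq0; apply/eqP.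
      by apply: eq_bigr => j _; rewrite dotZr.
    rewrite psumr_eq0; last by move=> j _; rewrite mulr_ge0 // subr_ge0.
    move=> /allP/(_ i); rewrite mem_index_enum mulf_eq0 (negbTE ai) subr_eq0 => /(_ isT) /eqP.
    by [].
  have [i0 ai0] : exists i0, a i0 != 0.
    apply/existsP; apply: contraT; rewrite negb_exists => /forallP H.
    by move: a1; rewrite big1 => [/eqP|i _]; [rewrite eq_sym oner_eq0 | have := H i; rewrite negbK => /eqP].
  exists k, (fun i => if a i == 0 then p i0 else p i), a; split=> //.
    move=> i; have pS j : a j != 0 -> [set pt z | z in [set` [set z in M | ev c z == b]%SET]] (p j).
      move=> aj; have [z /= zM ez] := pM j; exists z => //=.
      by rewrite inE zM /= /ev ez z0.
    by case: (eqVneq (a i) 0) => [_|ai]; apply: pS.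
  by apply: eq_bigr => i _; case: (eqVneq (a i) 0) => [->|//]; rewrite !scale0r.
move=> xS; split; first by apply: hull_mono xS; apply/fintype.subsetP => z; rewrite inE => /andP[].
have [k [p [a [pS a0 a1 ->]]]] := xS; rewrite dot_sumr -[RHS]mul1r -a1 mulr_suml.
apply: eq_bigr => i _; rewrite dotZr; congr (_ * _).
by have [z /= + <-] := pS i; rewrite inE => /andP[_ /eqP].
Qed.

Lemma vertices_face c b :
  vertices [set x | P x /\ dot c x = b] = [set z in M | ev c z == b]%SET.
Proof.
apply/setP => z; rewrite [LHS]inE [RHS]inE; case zM: (z \in M) => //=.
by apply/asboolP/eqP => [[]//|e]; split=> //; apply: pt_hull.
Qed.

Lemma is_faceP F : is_face P F <-> exists2 S, exposed R v w S & F = hull S.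
Proof.
split=> [[c [b [cb ->]]]|[S [c [b [cb ->]]] ->]].
  have cb' z : z \in M -> ev c z <= b by move=> zM; apply/cb/pt_hull.
  by exists [set z in M | ev c z == b]%SET; [exists c, b | apply: face_hull].
exists c, b; split; last by rewrite face_hull.
move=> x [k [p [a [pM a0 a1 ->]]]]; rewrite dot_sumr -[leRHS]mul1r -a1 mulr_suml.
apply: ler_sum => i _; rewrite dotZr ler_wpM2l //.
by have [z /= zM <-] := pM i; apply: cb.
Qed.

Lemma vertices_hull S : exposed R v w S -> vertices (hull S) = S.
Proof. by case=> c [b [cb ->]]; rewrite -face_hull // vertices_face. Qed.

Lemma face_vertices F : is_face P F -> exposed R v w (vertices F) /\ F = hull (vertices F).
Proof. by case/is_faceP => S eS ->; rewrite vertices_hull. Qed.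

Lemma face_subset F G : is_face P F -> is_face P G -> F `<=` G <-> vertices F \subset vertices G.
Proof.
move=> /face_vertices[eF FE] /face_vertices[eG GE]; split=> [FG|].
  by apply/fintype.subsetP => z; rewrite !inE => /andP[-> /asboolP/FG ?]; apply/asboolP.
by rewrite FE GE !vertices_hull //; apply: hull_mono.
Qed.

End Faces.

Local Open Scope classical_set_scope.

Theorem corollary5p2 (R : realType) (n m : nat) (v w : 'S_n) (v' w' : 'S_m) :
  bruhat_le v w -> bruhat_le v' w' ->
  toric R v w -> toric R v' w' ->
  poset_isomorphic
    [set` bruhat_interval v w] (fun x y => bruhat_le x y)
    [set` bruhat_interval v' w'] (fun x y => bruhat_le x y) ->
  combinatorially_equivalent (bruhat_polytope R v w) (bruhat_polytope R v' w').
Proof.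
move=> vw vw' tor tor' [f [[ffun finj fsurj] fle]].
have fM z : z \in bruhat_interval v w -> f z \in bruhat_interval v' w' by apply: ffun.
have fI z z' : z \in bruhat_interval v w -> z' \in bruhat_interval v w -> f z = f z' -> z = z'.
  by move=> zM zM'; apply: finj; rewrite inE.
have le_f x y : x \in bruhat_interval v w -> y \in bruhat_interval v w ->
    bruhat_le (f x) (f y) = bruhat_le x y.
  by move=> xM yM; apply/idP/idP => /fle; apply.
have mem_le x p q : bruhat_le v p -> bruhat_le q w -> bruhat_le p x -> bruhat_le x q ->
    x \in bruhat_interval v w.
  by move=> vp qw px xq; rewrite mem_bruhat_interval (bruhat_le_trans vp px) (bruhat_le_trans xq qw).
have fitv p q : bruhat_le v p -> bruhat_le p q -> bruhat_le q w ->
    [set f z | z in bruhat_interval p q]%SET = bruhat_interval (f p) (f q).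
  move=> vp pq qw; have pM := mem_le p p q vp qw (bruhat_le_refl p) pq.
  have qM := mem_le q p q vp qw pq (bruhat_le_refl q).
  apply/setP => y; apply/imsetP/idP => [[z]|].
    rewrite mem_bruhat_interval => /andP[pz zq] ->; have zM := mem_le z p q vp qw pz zq.
    by rewrite mem_bruhat_interval !le_f ?pz.
  rewrite mem_bruhat_interval => /andP[py yq].
  have : y \in bruhat_interval v' w'.
    have := fM p pM; have := fM q qM; rewrite !mem_bruhat_interval => /andP[_ qw'] /andP[vp' _].
    by rewrite (bruhat_le_trans vp' py) (bruhat_le_trans yq qw').
  move=> /fsurj[z zM ey]; exists z => //; rewrite mem_bruhat_interval.
  by rewrite -(le_f p z pM zM) -(le_f z q zM qM) ey py.
have sub_itv S : exposed R v w S -> S \subset bruhat_interval v w.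
  by case=> c [b [_ ->]]; apply/fintype.subsetP => z; rewrite inE => /andP[].
have fexp S : exposed R v w S -> exposed R v' w' [set f z | z in S]%SET.
  case/(exposed_is_interval tor) => [->|[p [q [vp pq qw ->]]]].
    by rewrite imset0; apply: exposed_set0.
  rewrite fitv //; have pM := mem_le p p q vp qw (bruhat_le_refl p) pq.
  have qM := mem_le q p q vp qw pq (bruhat_le_refl q).
  have := fM p pM; have := fM q qM; rewrite !mem_bruhat_interval => /andP[_ qw'] /andP[vp' _].
  by apply: interval_exposed; rewrite ?le_f.
have fsub S T : exposed R v w S -> exposed R v w T ->
    ([set f z | z in S]%SET \subset [set f z | z in T]%SET) = (S \subset T).
  move=> /sub_itv/fintype.subsetP SM /sub_itv/fintype.subsetP TM.
  apply/fintype.subsetP/fintype.subsetP => sub z; last first.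
    by case/imsetP=> z' /sub z'T ->; apply: imset_f.
  move=> zS; have /imsetP[z' z'T e] := sub _ (imset_f f zS).
  by rewrite (fI z z' (SM z zS) (TM z' z'T) e).
pose Phi (F : set 'rV[R]_n) := @hull R _ [set f z | z in vertices v w F]%SET.
have PhiV F : is_face (bruhat_polytope R v w) F ->
    vertices v' w' (Phi F) = [set f z | z in vertices v w F]%SET.
  by move=> /face_vertices[eF _]; apply/vertices_hull/fexp.
have PhiF F : is_face (bruhat_polytope R v w) F -> is_face (bruhat_polytope R v' w') (Phi F).
  by move=> /face_vertices[eF _]; apply/is_faceP; exists [set f z | z in vertices v w F]%SET; [apply: fexp|].
have Phi_le F G : is_face (bruhat_polytope R v w) F -> is_face (bruhat_polytope R v w) G ->
    (Phi F `<=` Phi G)%classic <-> (F `<=` G)%classic.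
  move=> fF fG; rewrite (face_subset (PhiF F fF) (PhiF G fG)) (face_subset fF fG) !PhiV //.
  by have [eF _] := face_vertices fF; have [eG _] := face_vertices fG; rewrite fsub.
exists Phi; split=> //; split=> [F|F G|G] /=.
- exact: PhiF.
- rewrite !inE => fF fG e; apply/seteqP; split.
    by apply/(Phi_le F G fF fG); rewrite e.
  by apply/(Phi_le G F fG fF); rewrite e.
move=> fG; have [eG GE] := face_vertices fG.
suff [S eS ES] : exists2 S, exposed R v w S & [set f z | z in S]%SET = vertices v' w' G.
  exists (@hull R _ S); first by apply/is_faceP; exists S.
  by rewrite /Phi vertices_hull // ES -GE.
case: (exposed_is_interval tor' eG) => [->|[p' [q' [vp' pq' qw' ->]]]].
  by exists finset.set0; [apply: exposed_set0 | rewrite imset0].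
have pM' : p' \in bruhat_interval v' w' by rewrite mem_bruhat_interval vp' (bruhat_le_trans pq' qw').
have qM' : q' \in bruhat_interval v' w' by rewrite mem_bruhat_interval qw' (bruhat_le_trans vp' pq').
have [p pM ep] := fsurj p' pM'; have [q qM eq] := fsurj q' qM'.
move: (pM) (qM); rewrite /= !mem_bruhat_interval => /andP[vp pw] /andP[vq qw].
have pq : bruhat_le p q by rewrite -(le_f p q pM qM) ep eq.
exists (bruhat_interval p q); first exact: interval_exposed.
by rewrite fitv // ep eq.
Qed.
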